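(* Let $Q$ be a smooth manifold and $L\colon\mathrm TQ\to\mathbf R$ an almost regular lagrangian. Let $\phi_\mu$ be a set of independent primary hamiltonian constraints and $H$ a hamiltonian function (on an open set of $\mathrm T^*Q$), let $\lambda^\mu$ be functions on an open set $\Omega\subset\mathrm TQ$ such that $\mathrm{Id}_{\mathrm TQ}=\gamma_H+\sum_\mu\gamma_\mu\lambda^\mu$ on $\Omega$, and let $\widehat{\mathcal M}$ be the associated operator $\mathrm V^*(\mathrm TQ)|_\Omega\to\mathrm V(\mathrm TQ)|_\Omega$ (all defined in the context). Let $X_0$ be any second-order vector field on $\mathrm TQ$. Then $$D_0=X_0+\widehat{\mathcal M}\circ(\widehat{\delta L}\circ X_0)$$ is a primary field (on $\Omega$): it is a second-order vector field with $\widehat{\delta L}\circ D_0=0$ at all points of the primary lagrangian constraint submanifold $V_1$ (in $\Omega$). More precisely, on $\Omega$, $$\widehat{\delta L}\circ D_0=\sum_\mu\chi_\mu\,(\mathrm D\lambda^\mu)^{\mathrm v},$$ which vanishes on $V_1$, where $\chi_\mu=\langle\widehat{\delta L}\circ X_0,\Gamma_\mu\rangle$ are the primary lagrangian constraints.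
   Context: All manifolds and maps are smooth. **Fibre derivatives.** For a bundle map $g\colon B\to F$ over a manifold $N$ between vector bundles over $N$ (or defined on an open subset of $B$), $\mathrm Dg\colon B\to\operatorname{Hom}(B,F)$ sends $b_x$ to the ordinary derivative at $b_x$ of $g|_{B_x}\colon B_x\to F_x$. For a real function $g$, $\mathrm Dg$ takes values in $B^*$, and $\mathrm D^2g=\mathrm D(\mathrm Dg)$. The Legendre's map is $\mathcal F=\mathrm DL\colon\mathrm TQ\to\mathrm T^*Q$. $L$ is almost regular if $\mathcal F$ has connected fibres and is a submersion onto a closed submanifold $P_0=\mathcal F(\mathrm TQ)\subset\mathrm T^*Q$. **Hamiltonian data.** Let $U\subset\mathrm T^*Q$ be open. A set of independent primary hamiltonian constraints on $U$ is a finite family of functions $\phi_\mu\colon U\to\mathbf R$ whose differentials are linearly independent at each point of $P_0\cap U$ and whose common zero set is $P_0\cap U$. The energy is $E(v_q)=\langle\mathrm DL(v_q),v_q\rangle-L(v_q)$. A hamiltonian function on $U$ is a function $H\colon U\to\mathbf R$ with $E=H\circ\mathcal F$ on $\mathcal F^{-1}(U)$. For a function $h$ on $U$, $\gamma_h=\mathrm Dh\circ\mathcal F\colon\mathcal F^{-1}(U)\to\mathrm TQ$ (using $\mathrm T^{**}Q\cong\mathrm TQ$), and $\gamma_\mu=\gamma_{\phi_\mu}$. Functions $\lambda^\mu$ with $\mathrm{Id}_{\mathrm TQ}=\gamma_H+\sum_\mu\gamma_\mu\lambda^\mu$ always exist locally, on open sets $\Omega\subset\mathcal F^{-1}(U)$.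 Put $M=(\mathrm D^2H\circ\mathcal F)+\sum_\mu(\mathrm D^2\phi_\mu\circ\mathcal F)\lambda^\mu\colon\Omega\to\operatorname{Hom}(\mathrm T^*Q,\mathrm TQ)$. **Vertical objects.** $\mathrm V(\mathrm TQ)\subset\mathrm T(\mathrm TQ)$ is the bundle of vertical vectors (tangent to the fibres of $\mathrm TQ\to Q$). For each $v_q\in\mathrm TQ$ the vertical lift $\mathrm{vl}(v_q,w_q)=\frac{d}{dt}\big|_{t=0}(v_q+tw_q)$ identifies $\mathrm T_qQ$ with $\mathrm V_{v_q}(\mathrm TQ)$, and dually $\mathrm T_q^*Q$ with $\mathrm V_{v_q}^*(\mathrm TQ)$. Through these identifications: - $\Gamma_\mu$ is the vertical vector field $\Gamma_\mu(v_q)=\mathrm{vl}(v_q,\gamma_\mu(v_q))$; - $(\mathrm D\lambda^\mu)^{\mathrm v}$ is the section of $\mathrm V^*(\mathrm TQ)$ corresponding to $\mathrm D\lambda^\mu\colon\Omega\to\mathrm T^*Q$; - $\widehat{\mathcal M}\colon\mathrm V^*(\mathrm TQ)|_\Omega\to\mathrm V(\mathrm TQ)|_\Omega$ is the vector bundle morphism given at $v_q$ by $M(v_q)\colon\mathrm T_q^*Q\to\mathrm T_qQ$. **Euler–Lagrange operator.** $\mathrm N(\mathrm TQ)\subset\mathrm T(\mathrm TQ)$ is the set of tangent vectors satisfying the second-order condition, i.e. in natural coordinates vectors $v^i\frac{\partial}{\partial q^i}+a^i\frac{\partial}{\partial v^i}$ at $(q,v)$; it is an affine bundle over $\mathrm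 TQ$ modelled on $\mathrm V(\mathrm TQ)$. A second-order vector field is a vector field on $\mathrm TQ$ with values in $\mathrm N(\mathrm TQ)$. $\widehat{\delta L}\colon\mathrm N(\mathrm TQ)\to\mathrm V^*(\mathrm TQ)$ is the affine bundle map over $\mathrm TQ$ (globally well defined) sending the vector above at $v_q=(q,v)$ to the element of $\mathrm V^*_{v_q}(\mathrm TQ)$ corresponding to the covector $$\left(\frac{\partial L}{\partial q^i}-\frac{\partial^2L}{\partial v^i\partial q^j}v^j-\frac{\partial^2L}{\partial v^i\partial v^j}a^j\right)dq^i\in\mathrm T_q^*Q$$ (this is the Euler–Lagrange form $\left(\frac{\partial L}{\partial q^i}-\mathrm D_t\frac{\partial L}{\partial v^i}\right)dq^i$ under the identification $\mathrm T^2Q\cong\mathrm N(\mathrm TQ)$). **Primary lagrangian constraints.** $V_1\subset\mathrm TQ$ is the set of points $v$ for which there exists $X_v\in\mathrm N(\mathrm TQ)$ over $v$ with $\widehat{\delta L}(X_v)=0$; it is assumed to be a closed submanifold. A primary (dynamical) field is a second-order vector field $X$ with $\widehat{\delta L}\circ X=0$ at all points of $V_1$. (Over $\Omega$, $V_1$ is the common zero set of the functions $\chi_\mu$, which is independent of the choice of $X_0$.) *)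

(* Defs.v *)
(* MathComp-Analysis; the ground field is an arbitrary R : realType. *)
From HB Require Import structures.
From mathcomp Require Import all_boot all_order all_algebra.
From mathcomp Require Import all_classical all_reals all_analysis.

Set Implicit Arguments.
Unset Strict Implicit.
Unset Printing Implicit Defensive.

Import Order.TTheory GRing.Theory Num.Theory.
Import numFieldNormedType.Exports.

Local Open Scope classical_set_scope.
Local Open Scope ring_scope.

(* C^k functions on an open set U.  The map df : E -> Hom(E, F) is handled in  *)
(* uncurried form (x, v) |-> df_x(v); since all spaces used below have finite  *)
(* dimension, this is C^k on U x E iff x |-> df_x is C^k on U.                 *)
Fixpoint Ck (R : realType) (k : nat) :
    forall E F : normedModType R, set E -> (E -> F) -> Prop :=
  match k with
  | 0 => fun E F U f => forall x, U x -> {for x, continuous f}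
  | k'.+1 => fun E F U f =>
      (forall x, U x -> differentiable f x) /\
      @Ck R k' (E * E)%type F (U `*` setT) (fun z => 'd f (z.1) z.2)
  end.

Definition smooth_in (R : realType) (E F : normedModType R) (U : set E)
  (f : E -> F) := forall k, Ck k U f.

(* A set with charts modelled on E.  The chart c is the bijection ccoord c from *)
(* cdom c onto the open set ccod c, with inverse param c (both are total       *)
(* functions whose values outside cdom c, resp. ccod c, are irrelevant).       *)
(* chart_at x is a chosen chart around x.  Compatibility of the charts is not  *)
(* part of the structure, see smooth_manifold.                                 *)
Record charted (R : realType) (E : normedModType R) := Charted {
  points :> Type;
  chart : Type;
  cdom : chart -> set points;
  ccod : chart -> set E;
  ccoord : chart -> points -> E;
  param : chart -> E -> points;
  chart_at : points -> chart;
  ccod_open : forall c, open (ccod c) }.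

Arguments chart {R E} _.
Arguments cdom {R E _} _ _.
Arguments ccod {R E _} _ _.
Arguments ccoord {R E _} _ _.
Arguments param {R E _} _ _.
Arguments chart_at {R E _} _.

Section Topology.
Context {R : realType} {E : normedModType R} (M : charted E).

Definition chart_open (A : set M) :=
  forall c : chart M, open (ccod c `&` param c @^-1` A).

Lemma chart_openT : chart_open setT.
Proof. by move=> c; rewrite preimage_setT setIT; exact: ccod_open. Qed.

Lemma chart_openI : setI_closed chart_open.
Proof.
move=> A B oA oB c.
by rewrite preimage_setI -[ccod c]setIid setIACA; apply: openI.
Qed.

Lemma chart_open_bigU (I : Type) (f : I -> set M) :
  (forall i, chart_open (f i)) -> chart_open (\bigcup_i f i).
Proof.
move=> of_ c; rewrite preimage_bigcup setI_bigcupr.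
by apply: bigcup_open => i _; exact: of_.
Qed.

End Topology.

HB.instance Definition _ (R : realType) (E : normedModType R) (M : charted E) :=
  gen_eqMixin (points M).
HB.instance Definition _ (R : realType) (E : normedModType R) (M : charted E) :=
  gen_choiceMixin (points M).
HB.instance Definition _ (R : realType) (E : normedModType R) (M : charted E) :=
  isOpenTopological.Build (points M)
    (@chart_openT R E M) (@chart_openI R E M) (@chart_open_bigU R E M).

Definition flat (R : realType) (E : normedModType R) : charted E :=
  @Charted R E E unit (fun=> setT) (fun=> setT) (fun=> id) (fun=> id)
    (fun=> tt) (fun=> openT).

Record smooth_manifold (R : realType) (E : normedModType R) (M : charted E) :
    Prop := SmoothManifold {
  mf_chart_at : forall x : M, cdom (chart_at x) x;
  mf_coord : forall (c : chart M) x, cdom c x -> ccod c (ccoord c x);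
  mf_param : forall (c : chart M) y, ccod c y -> cdom c (param c y);
  mf_coordK : forall (c : chart M) x, cdom c x -> param c (ccoord c x) = x;
  mf_paramK : forall (c : chart M) y, ccod c y -> ccoord c (param c y) = y;
  mf_open : forall c d : chart M, open (ccod c `&` param c @^-1` cdom d);
  mf_smooth : forall c d : chart M,
    smooth_in (ccod c `&` param c @^-1` cdom d) (ccoord d \o param c);
  mf_hausdorff : hausdorff_space M;
  mf_countable : @second_countable M }.

Lemma change_id (R : realType) (E : normedModType R) (M : charted E) :
  smooth_manifold M -> forall (c : chart M) x (w : E), cdom c x ->
  'd (ccoord c \o param c) (ccoord c x) w = w.
Proof.
move=> hM c x w cx.
have near_id : \forall y \near ccoord c x, id y = (ccoord c \o param c) y.
  near=> y => /=; rewrite (mf_paramK hM) //; near: y.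
  by apply: open_nbhs_nbhs; split; [exact: ccod_open | exact: mf_coord].
have df : differentiable (ccoord c \o param c) (ccoord c x).
  have /= [+ _] := (mf_smooth hM c c 1%N); apply.
  split; first exact: mf_coord.
  by rewrite /= (mf_coordK hM).
rewrite -deriveE // -(near_eq_derive _ near_id).
by rewrite derive_id.
Unshelve. all: by end_near. Qed.

(* The openness of the domains of all local expressions says that f is         *)
(* continuous on the open set A.                                               *)
Definition smooth_on (R : realType) (E F : normedModType R) (M : charted E)
    (N : charted F) (A : set M) (f : M -> N) :=
  forall (c : chart M) (d : chart N),
    let V := ccod c `&` param c @^-1` (A `&` f @^-1` cdom d) in
    open V /\ smooth_in V (ccoord d \o f \o param c).

Definition smooth_fun (R : realType) (E : normedModType R) (M : charted E)
  (A : set M) (f : M -> R) := smooth_on (N := flat R^o) A f.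

(* A tangent vector at x is stored by its components in the chart chart_at x,  *)
(* so that T_x M is the vector space E; its components in another chart c are  *)
(* obtained by applying the derivative of the change of coordinates.           *)
Record tvec (R : realType) (E : normedModType R) (M : charted E) :=
  TVec { tbase : M; tfib : E }.

Arguments TVec {R E M} _ _.

Section Tangent.
Context {R : realType} {E : normedModType R} (M : charted E).

Definition tcod (c : chart M) : set (E * E)%type := ccod c `*` setT.

Lemma tcod_open c : open (tcod c).
Proof.
have -> : tcod c = fst @^-1` ccod c.
  by apply/seteqP; split => z /=; [case | split].
apply: open_comp; last exact: ccod_open.
by move=> z _; exact: cvg_fst.
Qed.

(* The natural charts of TM. *)
Definition tangent : charted (E * E)%type :=
  @Charted R (E * E)%type (tvec M) (chart M)
    (fun c => [set X | cdom c (tbase X)])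
    tcod
    (fun c X => let x := tbase X in
      (ccoord c x,
       'd (ccoord c \o param (chart_at x)) (ccoord (chart_at x) x) (tfib X)))
    (fun c z => let x := param c z.1 in
      TVec x ('d (ccoord (chart_at x) \o param c) (z.1) z.2))
    (fun X => chart_at (tbase X))
    tcod_open.

Definition velocity (g : R -> M) (t : R) : tangent :=
  TVec (g t) (derive1 (ccoord (chart_at (g t)) \o g) t).

End Tangent.

(* The tangent map of f at x; for real functions this is the differential.     *)
Definition mdiff (R : realType) (E F : normedModType R) (M : charted E)
    (N : charted F) (f : M -> N) (x : M) : E -> F :=
  'd (ccoord (chart_at (f x)) \o f \o param (chart_at x))
     (ccoord (chart_at x) x).

Section Submanifolds.
Context {R : realType}.

Definition slice_chart (E : normedModType R) (M : charted E) (S : set M) (x : M)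
    (k l : nat) (W : set M) (psi : M -> flat ('rV[R]_k * 'rV[R]_l)%type) :=
  [/\ open W /\ W x,
      open (psi @` W),
      smooth_on W psi,
      exists2 theta : flat ('rV[R]_k * 'rV[R]_l)%type -> M,
        forall y, W y -> theta (psi y) = y & smooth_on (psi @` W) theta &
      forall y, W y -> (S y <-> (psi y).2 = 0)].

Definition closed_submanifold (E : normedModType R) (M : charted E)
    (S : set M) :=
  closed S /\
  forall x, S x -> exists k l W (psi : M -> flat ('rV[R]_k * 'rV[R]_l)%type),
    slice_chart S x W psi.

(* If f takes its values in the submanifold S, then fst \o psi is a chart of S *)
(* for every slice chart psi, and the last clause says that the tangent map    *)
(* of f : N -> S is surjective at every point.                                 *)
Definition submersion_onto (E F : normedModType R) (N : charted E)
    (M : charted F) (f : N -> M) (S : set M) :=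
  S = range f /\
  forall x k l W (psi : M -> flat ('rV[R]_k * 'rV[R]_l)%type),
    slice_chart S (f x) W psi ->
    forall w, exists u,
      mdiff (N := flat 'rV[R]_k) (fun y => (psi (f y)).1) x u = w.

End Submanifolds.

Definition pair_cov (R : realType) (n : nat) (a : 'cV[R]_n) (w : 'rV[R]_n) : R :=
  (w *m a) 0 0.

(* Covectors at x are stored by their components (as columns) in chart_at x.   *)
Record cvec (R : realType) (n : nat) (Q : charted 'rV[R]_n) :=
  CVec { cbase : Q; cfib : 'cV[R]_n }.

Arguments CVec {R n Q} _ _.

Section Cotangent.
Context {R : realType} {n : nat} (Q : charted 'rV[R]_n).

Definition ctcod (c : chart Q) : set ('rV[R]_n * 'cV[R]_n)%type :=
  ccod c `*` setT.

Lemma ctcod_open c : open (ctcod c).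
Proof.
have -> : ctcod c = fst @^-1` ccod c.
  by apply/seteqP; split => z /=; [case | split].
apply: open_comp; last exact: ccod_open.
by move=> z _; exact: cvg_fst.
Qed.

Definition pullback (f : 'rV[R]_n -> 'rV[R]_n) (y : 'rV[R]_n) (a : 'cV[R]_n) :
  'cV[R]_n := \col_i pair_cov a ('d f y (delta_mx 0 i)).

(* The natural charts of T^*Q. *)
Definition cotangent : charted ('rV[R]_n * 'cV[R]_n)%type :=
  @Charted R ('rV[R]_n * 'cV[R]_n)%type (cvec Q) (chart Q)
    (fun c => [set p | cdom c (cbase p)])
    ctcod
    (fun c p => let x := cbase p in
      (ccoord c x,
       pullback (ccoord (chart_at x) \o param c) (ccoord c x) (cfib p)))
    (fun c z => let x := param c z.1 in
      CVec x (pullback (ccoord c \o param (chart_at x))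
                (ccoord (chart_at x) x) z.2))
    (fun p => chart_at (cbase p))
    ctcod_open.

End Cotangent.

Section FibreDerivatives.
Context {R : realType} {n : nat} {Q : charted 'rV[R]_n}.

Definition fibD (g : tangent Q -> R) (v : tangent Q) : 'cV[R]_n :=
  \col_i 'd (fun w => g (TVec (tbase v) w) : R^o) (tfib v) (delta_mx 0 i).

(* T_q^{**}Q is identified with T_qQ (row vectors). *)
Definition cofibD (h : cotangent Q -> R) (p : cotangent Q) : 'rV[R]_n :=
  \row_i 'd (fun a => h (CVec (cbase p) a) : R^o) (cfib p) (delta_mx i 0).

Definition cofibD2 (h : cotangent Q -> R) (p : cotangent Q) :
    'cV[R]_n -> 'rV[R]_n :=
  'd (fun a => cofibD h (CVec (cbase p) a)) (cfib p).

End FibreDerivatives.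

Section Lagrangian.
Context {R : realType} {n : nat} {Q : charted 'rV[R]_n}.
Context (L : tangent Q -> R).

Definition legendre (v : tangent Q) : cotangent Q := CVec (tbase v) (fibD L v).

Definition P0 : set (cotangent Q) := range legendre.

Definition almost_regular :=
  [/\ forall p, P0 p -> connected (legendre @^-1` [set p]),
      closed_submanifold P0 & submersion_onto legendre P0].

Definition energy (v : tangent Q) : R := pair_cov (fibD L v) (tfib v) - L v.

Definition hamiltonian_function (U : set (cotangent Q)) (H : cotangent Q -> R) :=
  smooth_fun U H /\ forall v, U (legendre v) -> energy v = H (legendre v).

Definition independent_primary_constraints (m : nat) (U : set (cotangent Q))
    (phi : 'I_m -> cotangent Q -> R) :=
  [/\ forall mu, smooth_fun U (phi mu),
      forall p, P0 p -> U p -> forall a : 'I_m -> R,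
        (forall w, \sum_mu a mu * mdiff (N := flat R^o) (phi mu) p w = 0) ->
        forall mu, a mu = 0 &
      forall p, U p -> (P0 p <-> forall mu, phi mu p = 0)].

(* An element of T_qQ, where q is the base point of v. *)
Definition gamma (h : cotangent Q -> R) (v : tangent Q) : 'rV[R]_n :=
  cofibD h (legendre v).

Definition Mop (m : nat) (H : cotangent Q -> R)
    (phi : 'I_m -> cotangent Q -> R) (lambda : 'I_m -> tangent Q -> R)
    (v : tangent Q) (a : 'cV[R]_n) : 'rV[R]_n :=
  cofibD2 H (legendre v) a +
  \sum_mu lambda mu v *: cofibD2 (phi mu) (legendre v) a.

Definition vl (v : tangent Q) (w : 'rV[R]_n) : tangent (tangent Q) :=
  velocity (fun t => TVec (tbase v) (tfib v + t *: w) : tangent Q) 0.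

Lemma vlE : smooth_manifold Q -> forall v w, vl v w = TVec v (0, w).
Proof.
move=> hQ [x v] w; rewrite /vl /velocity /= scale0r addr0; congr TVec.
rewrite (_ : _ \o _ = fun t : R^o => (ccoord (chart_at x) x, v + t *: w)); last first.
  by apply: funext => t /=; rewrite change_id //; exact: mf_chart_at.
rewrite derive1E.


pose f := fun t : R^o => (ccoord (chart_at x) x, v + t *: w).
have df : is_diff (0 : R^o) f (fun t : R^o => (0 : 'rV[R]_n, 0 + t *: w)).
  exact: (is_diff_pair (is_diff_cst (ccoord (chart_at x) x) _)
    (is_diffD (is_diff_cst v _) (is_diff_scalel (0 : R) w))).
have -> : 'D_1 f 0 = 'd f (0:R^o) 1 by rewrite deriveE //; exact: ex_diff.
by rewrite diff_val scale1r add0r.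
Qed.

(* Elements of V^*(TQ): vfib is the covector of T_q^*Q, q = tbase vbase, which *)
(* corresponds to the element of V_vbase^*(TQ) under the dual of vl.           *)
Record vcovec := VCov { vbase : tangent Q; vfib : 'cV[R]_n }.

(* Pairing with a vertical vector X = vl v w; w is read off from X by vlE.     *)
Definition vpair (xi : vcovec) (X : tangent (tangent Q)) : R :=
  pair_cov (vfib xi) (tfib X).2.

Lemma vpairE : smooth_manifold Q ->
  forall v a w, vpair (VCov v a) (vl v w) = pair_cov a w.
Proof. by move=> hQ v a w; rewrite vlE. Qed.

Definition Gamma (h : cotangent Q -> R) (v : tangent Q) :
  tangent (tangent Q) := vl v (gamma h v).

Definition Dv (f : tangent Q -> R) (v : tangent Q) : vcovec := VCov v (fibD f v).

Definition Mhat (m : nat) (H : cotangent Q -> R)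
    (phi : 'I_m -> cotangent Q -> R) (lambda : 'I_m -> tangent Q -> R)
    (xi : vcovec) : tangent (tangent Q) :=
  vl (vbase xi) (Mop H phi lambda (vbase xi) (vfib xi)).

(* Addition in the fibres of T(TQ); only used when tbase X = tbase Y. *)
Definition tadd (X Y : tangent (tangent Q)) : tangent (tangent Q) :=
  TVec (tbase X) (tfib X + tfib Y).

(* N(TQ): in natural coordinates X = ((q, v), (v, a)). *)
Definition second_order (X : tangent (tangent Q)) :=
  (tfib X).1 = tfib (tbase X).

Definition second_order_field (A : set (tangent Q))
    (X : tangent Q -> tangent (tangent Q)) :=
  smooth_on A X /\
  forall v, A v -> tbase (X v) = v /\ second_order (X v).

Section Coordinates.
Implicit Types f : 'rV[R]_n * 'rV[R]_n -> R^o.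

Definition dq (i : 'I_n) f : 'rV[R]_n * 'rV[R]_n -> R^o :=
  'D_(delta_mx 0 i, 0) f.

Definition dv (i : 'I_n) f : 'rV[R]_n * 'rV[R]_n -> R^o :=
  'D_(0, delta_mx 0 i) f.

End Coordinates.

(* Computed in the natural coordinates given by chart_at q, in which covectors *)
(* of T_q^*Q are stored.                                                       *)
Definition deltaL (X : tangent (tangent Q)) : vcovec :=
  let c := chart_at (tbase X) in
  let z := ccoord c (tbase X) in
  let a := (tfib X).2 in
  let Lc : 'rV[R]_n * 'rV[R]_n -> R^o := L \o param c in
  VCov (tbase X)
    (\col_i (dq i Lc z - \sum_j dv i (dq j Lc) z * z.2 0 j
                       - \sum_j dv i (dv j Lc) z * a 0 j)).

Definition V1 : set (tangent Q) :=
  [set v | exists X : tangent (tangent Q),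
     [/\ tbase X = v, second_order X & vfib (deltaL X) = 0]].

Definition primary_field (A : set (tangent Q))
    (X : tangent Q -> tangent (tangent Q)) :=
  second_order_field A X /\
  forall v, A v -> V1 v -> vfib (deltaL (X v)) = 0.

Definition chi (X0 : tangent Q -> tangent (tangent Q)) (h : cotangent Q -> R)
  (v : tangent Q) : R := vpair (deltaL (X0 v)) (Gamma h v).

Definition D0 (m : nat) (H : cotangent Q -> R)
    (phi : 'I_m -> cotangent Q -> R) (lambda : 'I_m -> tangent Q -> R)
    (X0 : tangent Q -> tangent (tangent Q)) (v : tangent Q) :
    tangent (tangent Q) :=
  tadd (X0 v) (Mhat H phi lambda (deltaL (X0 v))).

End Lagrangian.

(* Main.v *)
(* Along a fibre of TQ, differentiating Id = gamma_H + sum gamma_mu lambda^mu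
   gives Id = M W + sum gamma_mu (x) D lambda^mu, where W = D^2 L.  Since M and W
   are symmetric, transposing yields alpha - W (M alpha) =
   sum <alpha, gamma_mu> D lambda^mu for every covector alpha, and the left-hand
   side is the Euler-Lagrange form of D_0 when alpha is that of X_0.  On V_1 the
   form of X_0 lies in the image of W, and W gamma_mu = D(phi_mu o F) = 0, so
   chi_mu vanishes there.  Smoothness of D_0 holds because in any chart its
   correction term is a smooth local expression; this uses that the
   Euler-Lagrange form transforms as a covector under changes of coordinates. *)
From HB Require Import structures.
Require Import Defs.
From mathcomp Require Import all_boot all_order all_algebra.
From mathcomp Require Import all_classical all_reals all_analysis.
From mathcomp Require Import ring.
Import Order.TTheory GRing.Theory Num.Theory.
Import numFieldNormedType.Exports.
Local Open Scope classical_set_scope.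
Local Open Scope ring_scope.

Set Implicit Arguments.
Unset Strict Implicit.
Unset Printing Implicit Defensive.

(** * Smooth maps *)

(** Vectors and covectors at [q] are stored in the components of [chart_at q], and nothing makes
    this chart depend continuously on [q]. Identities at a single point do not see this: with [q]
    frozen they concern functions on spaces of rows and columns, and all the algebra of the operator
    M takes place in one fibre. Smoothness of [D0] does see it, since the defining formula may
    switch charts from point to point. So the momentum, the second fibre derivatives of [H] and
    [phi mu], and the Euler-Lagrange form are all re-expressed in one fixed chart. Only for the
    Euler-Lagrange form do second derivatives of the change of charts appear and have to cancel. The
    transposition is not carried out on matrices: the resolution of the identity is paired with a
    constant covector and the resulting scalar function is differentiated. Finally [D0] also serves
    to characterise [V1]: where all [chi] vanish, it provides the second-order vector killed by
    [deltaL]. *)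

Lemma near_is_diff (R : realType) (E F : normedModType R) (f g df : E -> F) x :
  (\forall y \near x, f y = g y) -> is_diff x f df -> is_diff x g df.
Proof.
move=> fg dfx.
have fgx : f x = g x by exact: (nbhs_singleton fg).
(* The difference vanishes near [x], so its remainder is zero there and its differential is [0];
   adding it to [f] carries the derivative over to [g]. *)
have h0 : is_diff x (g - f) 0.
  have e : (g - f) \o shift x = cst ((g - f) x) + (0 : E -> F) +o_ 0 id.
    apply/eqaddoP => _/posnumP[e].
    have : \forall h \near (0 : E), f (h + x) = g (h + x).
      by move: fg; rewrite (near_shift 0) subr0.
    apply: filterS => h /= fgh.
    rewrite [X in `|X| <= _](_ : _ = 0) ?normr0 ?mulr_ge0 //.
    by rewrite -[LHS]/(g (h + x) - f (h + x) - (g x - f x + 0)) fgh fgx !subrr addr0 subrr.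
  have c0 : continuous (0 : E -> F) by exact: cst_continuous.
  have d0 : 'd (g - f) x = 0 :> (E -> F) by apply: diff_unique.
  by split => //; apply/diff_locallyP; split; rewrite d0.
have := is_diffD dfx h0.
by rewrite addrC subrK addr0.
Qed.

Lemma near_diffE (R : realType) (E F : normedModType R) (f g : E -> F) x :
  (\forall y \near x, f y = g y) -> differentiable f x ->
  'd f x = 'd g x :> (E -> F).
Proof.
move=> fg /differentiableP df.
by rewrite (@diff_val _ _ _ _ _ _ _ (near_is_diff fg df)).
Qed.

Section CkCalculus.
Context {R : realType}.
Implicit Types E F G : normedModType R.

Lemma open_prodT E F (U : set E) : open U -> open (U `*` [set: F]).
Proof.
move=> oU; have -> : U `*` [set: F] = fst @^-1` U.
  by apply/seteqP; split => z /=; [case | split].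
by apply: open_comp => // z _; exact: cvg_fst.
Qed.

Lemma Ck_sub k E F (U V : set E) (f : E -> F) :
  V `<=` U -> Ck k U f -> Ck k V f.
Proof.
elim: k E F U V f => [|k IH] E F U V f VU /=; first by move=> h x /VU /h.
move=> [df Cf]; split; first by move=> x /VU /df.
by apply: IH Cf => -[x v] [/= /VU].
Qed.

(** Equality on an open set is equality of germs at each of its points, so the differentials agree
    as well and the induction goes on. This lets smoothness be checked on a convenient formula that
    is valid only on [U]. *)
Lemma Ck_eq k E F (U : set E) (f g : E -> F) :
  open U -> (forall x, U x -> f x = g x) -> Ck k U f -> Ck k U g.
Proof.
elim: k E F U f g => [|k IH] E F U f g oU fg /=.
  move=> cf x Ux; move: (fg x Ux); rewrite /prop_for /continuous_at => <-.
  apply: cvg_trans (cf _ Ux); apply: near_eq_cvg.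
  by apply: filterS (open_nbhs_nbhs (conj oU Ux)) => y /fg ->.
have n x : U x -> \forall y \near x, f y = g y.
  by move=> Ux; apply: filterS (open_nbhs_nbhs (conj oU Ux)).
move=> [df Cf]; split.
  move=> x Ux.
  by have := near_is_diff (n x Ux) (differentiableP (df x Ux)).
apply: IH Cf; first exact: open_prodT.
by move=> [x v] [/= Ux _]; rewrite (near_diffE (n x Ux)) //; exact: df.
Qed.

Lemma CkS k E F (U : set E) (f : E -> F) : Ck k.+1 U f -> Ck k U f.
Proof.
elim: k E F U f => [|k IH] E F U f; last by move=> [df Cf]; split => //; exact: IH.
by move=> [df _] x /df /differentiable_continuous.
Qed.

Lemma Ck_lin k E F (U : set E) (f : {linear E -> F}) :
  continuous f -> Ck k U f.
Proof.
elim: k E F U f => [|k IH] E F U f cf /=; first by move=> x _; exact: cf.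
split; first by move=> x _; exact: linear_differentiable.
have -> : (fun z : E * E => 'd f (z.1) z.2) = f \o snd.
  by apply: funext => z /=; rewrite diff_lin.
by apply: IH => z; apply: continuous_comp; [exact: cvg_snd | exact: cf].
Qed.

Lemma Ck_id k E (U : set E) : Ck k U (fun x => x).
Proof. by apply: (Ck_lin _ _ (f := idfun)) => x; exact: cvg_id. Qed.

Lemma Ck_fst k E F (U : set (E * F)) : Ck k U fst.
Proof. by apply: (Ck_lin _ _ (f := fst)) => x; exact: cvg_fst. Qed.

Lemma Ck_snd k E F (U : set (E * F)) : Ck k U snd.
Proof. by apply: (Ck_lin _ _ (f := snd)) => x; exact: cvg_snd. Qed.

Lemma Ck_cst k E F (U : set E) (a : F) : Ck k U (fun=> a).
Proof.
elim: k E F U a => [|k IH] E F U a /=; first by move=> x _; exact: cst_continuous.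
split; first by move=> x _; exact: differentiable_cst.
have -> : (fun z : E * E => 'd (fun=> a) (z.1) z.2) = fun=> 0 :> F.
  by apply: funext => z; rewrite (diff_cst a).
exact: IH.
Qed.

Lemma Ck_pair k E F G (U : set E) (f : E -> F) (g : E -> G) :
  open U -> Ck k U f -> Ck k U g -> Ck k U (fun x => (f x, g x)).
Proof.
elim: k E F G U f g => [|k IH] E F G U f g oU /=.
  by move=> cf cg x Ux; apply: cvg_pair; [exact: cf | exact: cg].
move=> [df Cf] [dg Cg]; split.
  by move=> x Ux; apply: differentiable_pair; [exact: df | exact: dg].
have oU' := open_prodT (F := E) oU.
apply: Ck_eq (IH _ _ _ _ _ _ oU' Cf Cg) => //.
by move=> [x v] [/= Ux _]; rewrite diff_pair; [| exact: df | exact: dg].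
Qed.

(** The uncurried differential of [g \o f] is that of [g] composed with
    [(x, v) |-> (f x, 'd f x v)], a map of class [Ck k]. The induction hypothesis, quantified over
    all spaces, applies to this composition. *)
Lemma Ck_comp k E F G (U : set E) (V : set F) (f : E -> F) (g : F -> G) :
  open U -> (forall x, U x -> V (f x)) ->
  Ck k U f -> Ck k V g -> Ck k U (g \o f).
Proof.
elim: k E F G U V f g => [|k IH] E F G U V f g oU UV.
  move=> cf cg x Ux; apply: continuous_comp; first exact: cf.
  by apply: cg; exact: UV.
move=> Cf' [dg Cg]; have [df Cf] := Cf'; split.
  move=> x Ux; apply: differentiable_comp; first exact: df.
  by apply: dg; exact: UV.
have oU' := open_prodT (F := E) oU.
have Cp : Ck k (U `*` [set: E]) (fun z => (f z.1, 'd f (z.1) z.2)).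
  apply: Ck_pair => //.
  apply: (IH _ _ _ _ U fst f) => //; first by case=> x v [].
    exact: Ck_fst.
  exact: CkS.
apply: Ck_eq (IH _ _ _ _ _ _ _ oU' _ Cp Cg) => //; last first.
  by case=> x v [/= Ux _]; split => //=; exact: UV.
by case=> x v [/= Ux _]; rewrite (diff_comp (df x Ux) (dg _ (UV _ Ux))).
Qed.

Lemma Ck_linear k E F G (U : set E) (f : E -> F) (g : {linear F -> G}) :
  open U -> continuous g -> Ck k U f -> Ck k U (fun x => g (f x)).
Proof.
by move=> oU cg Cf; apply: (Ck_comp (V := setT) (f := f) (g := g)) => //; exact: Ck_lin.
Qed.

Lemma Ck_add k E F (U : set E) (f g : E -> F) :
  open U -> Ck k U f -> Ck k U g -> Ck k U (fun x => f x + g x).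
Proof.
elim: k E F U f g => [|k IH] E F U f g oU /=.
  by move=> cf cg x Ux; apply: cvgD; [exact: cf | exact: cg].
move=> [df Cf] [dg Cg]; split.
  by move=> x Ux; apply: (differentiableD (f := f)); [exact: df | exact: dg].
have oU' := open_prodT (F := E) oU.
apply: Ck_eq (IH _ _ _ _ _ oU' Cf Cg) => //.
by move=> [x v] [/= Ux _]; rewrite (@diffD _ _ _ f g); [| exact: df | exact: dg].
Qed.

Lemma Ck_sum k E F (U : set E) n (f : 'I_n -> E -> F) :
  open U -> (forall i, Ck k U (f i)) -> Ck k U (fun x => \sum_i f i x).
Proof.
move=> oU Cf; rewrite -[fun _ => _]/(fun x => \sum_(i <- index_enum 'I_n) f i x).
elim: (index_enum 'I_n) => [|i s IH].
  by apply: Ck_eq (Ck_cst k U 0) => // x _; rewrite big_nil.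
by apply: Ck_eq (Ck_add oU (Cf i) IH) => // x _; rewrite big_cons.
Qed.

Lemma Ck_mul k E (U : set E) (f g : E -> R^o) :
  open U -> Ck k U f -> Ck k U g -> Ck k U (fun x => f x * g x : R^o).
Proof.
elim: k E U f g => [|k IH] E U f g oU.
  by move=> cf cg x Ux; apply: cvgM; [exact: cf | exact: cg].
move=> Cf' Cg'; have [df Cf] := Cf'; have [dg Cg] := Cg'; split.
  by move=> x Ux; apply: (differentiableM (f := f)); [exact: df | exact: dg].
have oU' := open_prodT (F := E) oU.
have fstC (h : E -> R^o) : Ck k.+1 U h -> Ck k (U `*` [set: E]) (h \o fst).
  move=> /CkS Ch; apply: Ck_comp Ch => //; first by case=> ? ? [].
  exact: Ck_fst.
apply: Ck_eq (Ck_add oU' (IH _ _ _ _ oU' (fstC _ Cf') Cg)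
                         (IH _ _ _ _ oU' (fstC _ Cg') Cf)) => //.
by move=> [x v] [/= Ux _]; rewrite (@diffM _ _ f g); [| exact: df | exact: dg].
Qed.

Lemma Ck_scalel k E F (U : set E) (f : E -> R^o) (w : F) :
  open U -> Ck k U f -> Ck k U (fun x => f x *: w).
Proof.
move=> oU Cf.
have sx_lin : linear ( *:%R ^~ w : R^o -> F) by move=> u y z; rewrite scalerDl scalerA.
pose sxlM := GRing.isLinear.Build _ _ _ _ _ sx_lin.
pose sxL : {linear R^o -> F} := HB.pack (( *:%R ^~ w) : R^o -> F) sxlM.
by apply: (Ck_linear (g := sxL)) => //; exact: scalel_continuous.
Qed.

End CkCalculus.

(** * Symmetry of second derivatives *)

Section SecondDerivative.
Context {R : realType} {E : normedModType R}.
Implicit Types (U : set E) (f : E -> R^o).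

Lemma Ck1_diff k (F : normedModType R) U (f : E -> F) x :
  Ck k.+1 U f -> U x -> differentiable f x.
Proof. by move=> [df _] /df. Qed.

Lemma Ck_diff k (F : normedModType R) U (f : E -> F) (u : E) :
  open U -> Ck k.+1 U f -> Ck k U (fun z => 'd f z u).
Proof.
move=> oU [_ Cf]; apply: (Ck_comp (f := fun z => (z, u)) _ _ _ Cf) => //.
by apply: Ck_pair => //; [exact: Ck_id | exact: Ck_cst].
Qed.

Lemma is_derive_line (f : E -> R^o) (a u : E) (s : R) :
  differentiable f (a + s *: u) ->
  is_derive (s : R^o) (1 : R^o) (fun r : R^o => f (a + r *: u) : R^o)
    ('d f (a + s *: u) u).
Proof.
move=> /differentiableP df.
have dl : is_diff (s : R^o) (fun r : R^o => a + r *: u) (fun r : R^o => 0 + r *: u).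
  exact: (is_diffD (is_diff_cst a _) (is_diff_scalel s u)).
have dc := is_diff_comp dl df.
rewrite -[fun _ => _]/(f \o (fun r : R^o => a + r *: u)).
split; first by apply: diff_derivable; exact: ex_diff.
rewrite deriveE; last exact: ex_diff.
by rewrite diff_val /= add0r scale1r.
Qed.

(** Mean value theorem twice: for [s |-> f (x + h *: v + s *: u) - f (x + s *: u)], then, at the
    value [s] so found, for [t |-> 'd f (x + s *: u + t *: v) u]. *)
Lemma second_difference U f (x u v : E) (h : R) :
  open U -> Ck 2 U f -> 0 < h ->
  (forall s t, s \in `[0, h] -> t \in `[0, h] -> U (x + s *: u + t *: v)) ->
  exists s t, [/\ s \in `[0, h], t \in `[0, h] &
    f (x + h *: u + h *: v) - f (x + h *: u) - (f (x + h *: v) - f x)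
    = 'd (fun z => 'd f z u) (x + s *: u + t *: v) v * h * h].
Proof.
move=> oU Cf h0 Uh.
have z0 : 0 \in `[0, h] by rewrite in_itv /= lexx ltW.
have hh : h \in `[0, h] by rewrite in_itv /= lexx ltW.
pose G := fun s : R^o => f (x + h *: v + s *: u) - f (x + s *: u) : R^o.
have dG s : s \in `[0, h] ->
    is_derive (s : R^o) (1 : R^o) G ('d f (x + h *: v + s *: u) u - 'd f (x + s *: u) u).
  move=> sh; have dU z : U z -> differentiable f z by move=> Uz; exact: Ck1_diff Cf Uz.
  apply: is_deriveB; apply: is_derive_line; apply: dU.
    by rewrite addrAC; exact: Uh.
  by rewrite -[_ + _]addr0 -(scale0r v); exact: Uh.
have itvW (s : R) : s \in `]0, h[ -> s \in `[0, h].
  by rewrite !in_itv /= => /andP[/ltW -> /ltW ->].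
have cont (g dg : R^o -> R^o) :
    (forall s, s \in `[0, h] -> is_derive (s : R^o) (1 : R^o) g (dg s)) ->
    {within `[0, h], continuous g}.
  move=> dg'; apply: derivable_within_continuous => s /dg' ?; exact: ex_derive.
have [s /itvW sh Gs] := MVT h0 (fun s sh => dG s (itvW s sh)) (cont _ _ dG).
pose K := fun t : R^o => 'd f (x + s *: u + t *: v) u : R^o.
have dK t : t \in `[0, h] ->
    is_derive (t : R^o) (1 : R^o) K ('d (fun z => 'd f z u) (x + s *: u + t *: v) v).
  move=> th; apply: (is_derive_line (f := fun z => 'd f z u : R^o)).
  by apply: Ck1_diff (Ck_diff u oU Cf) _; exact: Uh.
have [t /itvW th Kt] := MVT h0 (fun s sh => dK s (itvW s sh)) (cont _ _ dK).
exists s, t; split => //.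
move: Gs Kt; rewrite /G /K !subr0 !scale0r !addr0 => Gs <-.
by rewrite [x + s *: u + _]addrAC -Gs [x + h *: u + _]addrAC.
Qed.

(** The second difference over a parallelogram at [x] is symmetric in [u] and [v]. Computed in both
    orders, it makes the two mixed derivatives agree at two points near [x], and continuity at [x]
    does the rest. *)
Lemma second_derivative_symmetric U f (x u v : E) :
  open U -> U x -> Ck 2 U f ->
  'd (fun z => 'd f z u) x v = 'd (fun z => 'd f z v) x u :> R.
Proof.
move=> oU Ux Cf.
pose A z := 'd (fun z => 'd f z u) z v : R^o.
pose B z := 'd (fun z => 'd f z v) z u : R^o.
have cA : {for x, continuous A} by apply: (Ck_diff v oU (Ck_diff u oU Cf)).
have cB : {for x, continuous B} by apply: (Ck_diff u oU (Ck_diff v oU Cf)).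
apply/eqP; rewrite -subr_eq0 -normr_le0; apply/ler_addgt0Pr => _ /posnumP[e].
rewrite add0r -/(A x) -/(B x).
have nW : \forall z \near x,
    [/\ U z, `|A x - A z| < e%:num / 2 & `|B x - B z| < e%:num / 2].
  near=> z; split; near: z.
  - exact: open_nbhs_nbhs.
  - by move/cvgrPdist_lt : cA; apply.
  - by move/cvgrPdist_lt : cB; apply.
have cl : (fun p : R^o * R^o => x + p.1 *: u + p.2 *: v) @ (0 : R^o, 0 : R^o) --> x.
  rewrite [X in _ --> X](_ : x = x + (0 : R) *: u + (0 : R) *: v); last first.
    by rewrite !scale0r !addr0.
  apply: cvgD; first apply: cvgD; first exact: cvg_cst.
    by apply: cvgZr_tmp; exact: cvg_fst.
  by apply: cvgZr_tmp; exact: cvg_snd.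
have /nbhs_ballP[r r0 rW] := cl _ nW.
(* Halving [r] puts the closed interval from [0] to [h] inside the open ball of radius [r]. *)
pose h : R := r / 2.
have h0 : 0 < h by rewrite divr_gt0.
have hW s t : s \in `[0, h] -> t \in `[0, h] ->
    [/\ U (x + s *: u + t *: v), `|A x - A (x + s *: u + t *: v)| < e%:num / 2 &
      `|B x - B (x + s *: u + t *: v)| < e%:num / 2].
  have hb (a : R) : a \in `[0, h] -> ball (0 : R^o) r a.
    rewrite in_itv /= => /andP[a0 ah].
    rewrite -ball_normE /= sub0r normrN ger0_norm //.
    by apply: le_lt_trans ah _; rewrite /h ltr_pdivrMr // mulr2n mulrDr mulr1 ltrDl.
  by move=> /hb sh /hb th; exact: (rW (s, t)).
have [s [t [sh th Auv]]] := second_difference (u := u) (v := v) oU Cf h0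
  (fun s t sh th => let: And3 a _ _ := hW s t sh th in a).
have hU' s' t' : s' \in `[0, h] -> t' \in `[0, h] -> U (x + s' *: v + t' *: u).
  by move=> sh' th'; rewrite addrAC; case: (hW t' s').
have [s' [t' [sh' th' Avu]]] := second_difference oU Cf h0 hU'.
have hn : h * h != 0 by rewrite mulf_neq0 // gt_eqF.
have AB : A (x + s *: u + t *: v) = B (x + t' *: u + s' *: v).
  apply: (mulIf hn); rewrite 2![_ * (h * h)]mulrA; apply: etrans (esym Auv) _.
  rewrite [x + t' *: u + _]addrAC; apply: (etrans _ Avu).
  rewrite [x + h *: v + _]addrAC; ring.
have [_ e1 _] := hW s t sh th; have [_ _ e2] := hW t' s' th' sh'.
apply: ltW; rewrite [e%:num]splitr.
rewrite (_ : A x - B x = (A x - A (x + s *: u + t *: v)) -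
                         (B x - B (x + t' *: u + s' *: v))).
  by apply: le_lt_trans (ler_normB _ _) _; exact: ltrD.
by rewrite AB opprB addrA subrK.
Unshelve. all: by end_near. Qed.

End SecondDerivative.

(** * Linear maps on matrix spaces and the pairing of covectors with vectors *)

Section LinearMaps.
Context {R : realType}.

Lemma linear_is_diff (E F : normedModType R) (f : E -> F) x :
  linear f -> continuous f -> is_diff x f f.
Proof.
move=> lf cf; pose fM := GRing.isLinear.Build _ _ _ _ _ lf.
pose fL : {linear E -> F} := HB.pack f fM.
by split; [exact: (linear_differentiable x (f := fL)) | exact: (@diff_lin _ _ _ fL)].
Qed.

(** Expanding the argument on the matrices [delta_mx i j] makes [f] a finite sum of entries times
    constant vectors. *)
Lemma mx_linear_continuous m n (F : normedModType R) (f : 'M[R]_(m, n) -> F) :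
  linear f -> continuous f.
Proof.
move=> lf; pose fM := GRing.isLinear.Build _ _ _ _ _ lf.
pose fL : {linear 'M[R]_(m, n) -> F} := HB.pack f fM.
have -> : f = fun A => \sum_i \sum_j (A i j : R^o) *: f (delta_mx i j).
  apply: funext => A; rewrite -[f]/(fL : _ -> _).
  rewrite [in LHS](matrix_sum_delta A) linear_sum.
  by apply: eq_bigr => i _; rewrite linear_sum; apply: eq_bigr => j _; rewrite linearZ.
have : Ck 0 setT (fun A : 'M[R]_(m, n) => \sum_i \sum_j (A i j : R^o) *: f (delta_mx i j)).
  apply: Ck_sum => [|i]; first exact: openT.
  apply: Ck_sum => [|j]; first exact: openT.
  by apply: Ck_scalel => [|A _]; [exact: openT | exact: coord_continuous].
by move=> h A; exact: h.
Qed.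

Lemma mx_linear_is_diff m n (F : normedModType R) (f : 'M[R]_(m, n) -> F) x :
  linear f -> is_diff x f f.
Proof. by move=> lf; apply: linear_is_diff => //; exact: mx_linear_continuous. Qed.

Lemma row_sumE n (w : 'rV[R]_n) : w = \sum_i w 0 i *: delta_mx 0 i.
Proof. exact: row_sum_delta. Qed.

Lemma col_sumE n (a : 'cV[R]_n) : a = \sum_i a i 0 *: delta_mx i 0.
Proof.
by rewrite {1}(matrix_sum_delta a); apply: eq_bigr => i _; rewrite big_ord1.
Qed.

Lemma pair_covE n (a : 'cV[R]_n) w : pair_cov a w = \sum_i w 0 i * a i 0.
Proof. by rewrite /pair_cov mxE. Qed.

Lemma pair_cov_delta n (a : 'cV[R]_n) i : pair_cov a (delta_mx 0 i) = a i 0.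
Proof. by rewrite /pair_cov -rowE mxE. Qed.

Lemma pair_cov_deltal n i (w : 'rV[R]_n) : pair_cov (delta_mx i 0) w = w 0 i.
Proof. by rewrite /pair_cov -colE mxE. Qed.

Lemma pair_cov_linear n (a : 'cV[R]_n) : linear (pair_cov a : 'rV[R]_n -> R^o).
Proof. by move=> k u v; rewrite /pair_cov mulmxDl -scalemxAl !mxE. Qed.

Lemma pair_cov_linearl n (w : 'rV[R]_n) :
  linear (fun a : 'cV[R]_n => pair_cov a w : R^o).
Proof. by move=> k a b; rewrite /pair_cov mulmxDr -scalemxAr !mxE. Qed.

Lemma pair_cov_inj n (a b : 'cV[R]_n) :
  (forall w, pair_cov a w = pair_cov b w) -> a = b.
Proof.
by move=> ab; apply/colP => i; have := ab (delta_mx 0 i); rewrite !pair_cov_delta.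
Qed.

Lemma pair_cov_injr n (v w : 'rV[R]_n) :
  (forall a, pair_cov a v = pair_cov a w) -> v = w.
Proof.
by move=> vw; apply/rowP => i; have := vw (delta_mx i 0); rewrite !pair_cov_deltal.
Qed.

(** The column of values on the basis represents the form [f]. This turns derivatives stored by
    components, as in [fibD] and [pullback], back into derivatives along arbitrary vectors. *)
Lemma pair_cov_col n (f : 'rV[R]_n -> R^o) (w : 'rV[R]_n) : linear f ->
  pair_cov (\col_i f (delta_mx 0 i)) w = f w.
Proof.
move=> lf; pose fM := GRing.isLinear.Build _ _ _ _ _ lf.
pose fL : {linear 'rV[R]_n -> R^o} := HB.pack f fM.
rewrite pair_covE -[f w]/(fL w) [in RHS](row_sumE w) linear_sum.
by apply: eq_bigr => i _; rewrite linearZ mxE.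
Qed.

Lemma pair_cov_row n (f : 'cV[R]_n -> R^o) (a : 'cV[R]_n) : linear f ->
  pair_cov a (\row_i f (delta_mx i 0)) = f a.
Proof.
move=> lf; pose fM := GRing.isLinear.Build _ _ _ _ _ lf.
pose fL : {linear 'cV[R]_n -> R^o} := HB.pack f fM.
rewrite pair_covE -[f a]/(fL a) [in RHS](col_sumE a) linear_sum.
by apply: eq_bigr => i _; rewrite linearZ mxE mulrC.
Qed.

Lemma pair_covD n (a : 'cV[R]_n) u v : pair_cov a (u + v) = pair_cov a u + pair_cov a v.
Proof. by rewrite /pair_cov mulmxDl mxE. Qed.

Lemma pair_covZ n (a : 'cV[R]_n) k v : pair_cov a (k *: v) = k * pair_cov a v.
Proof. by rewrite /pair_cov -scalemxAl mxE. Qed.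

Lemma pair_cov_sum n (a : 'cV[R]_n) m (v : 'I_m -> 'rV[R]_n) :
  pair_cov a (\sum_i v i) = \sum_i pair_cov a (v i).
Proof. by rewrite /pair_cov mulmx_suml summxE. Qed.

Lemma pair_covDl n (a b : 'cV[R]_n) v : pair_cov (a + b) v = pair_cov a v + pair_cov b v.
Proof. by rewrite /pair_cov mulmxDr mxE. Qed.

Lemma pair_covNl n (a : 'cV[R]_n) v : pair_cov (- a) v = - pair_cov a v.
Proof. by rewrite /pair_cov mulmxN mxE. Qed.

Lemma pair_covZl n (a : 'cV[R]_n) k v : pair_cov (k *: a) v = k * pair_cov a v.
Proof. by rewrite /pair_cov -scalemxAr mxE. Qed.

Lemma pair_cov_suml n m (a : 'I_m -> 'cV[R]_n) v :
  pair_cov (\sum_i a i) v = \sum_i pair_cov (a i) v.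
Proof. by rewrite /pair_cov mulmx_sumr summxE. Qed.

End LinearMaps.

(** * Chain rules for first and second derivatives *)

Section DerivativeFormulas.
Context {R : realType}.
Implicit Types E F G : normedModType R.

Lemma diff_lincomp E F G (f : E -> F) (l : F -> G) x u :
  linear l -> continuous l -> differentiable f x ->
  'd (fun y => l (f y)) x u = l ('d f x u).
Proof.
move=> ll cl df; have dl := linear_is_diff (f x) ll cl.
by rewrite (@diff_comp _ _ _ _ f l) // diff_val.
Qed.

Lemma diff_compE E F G (f : E -> F) (g : F -> G) x u :
  differentiable f x -> differentiable g (f x) ->
  'd (g \o f) x u = 'd g (f x) ('d f x u).
Proof. by move=> df dg; rewrite diff_comp. Qed.

Lemma diff_pairE E F G (f : E -> F) (g : E -> G) x u :
  differentiable f x -> differentiable g x ->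
  'd (fun y => (f y, g y)) x u = ('d f x u, 'd g x u).
Proof. by move=> df dg; rewrite diff_pair. Qed.

Lemma diff_affine E F G (g l : E -> F) (f : F -> G) x u :
  is_diff x g l -> differentiable f (g x) ->
  'd (fun y => f (g y)) x u = 'd f (g x) (l u).
Proof. by move=> dg df; rewrite (@diff_comp _ _ _ _ g f) //= diff_val. Qed.

(** Having the same differential [l] at every point, [g] is affine, so no second derivative of [g]
    enters. Inclusions of a fibre into a chart are of this kind. *)
Lemma diff2_affine E F (V : set F) (g l : E -> F) (f : F -> R^o) x u v :
  open V -> Ck 2 V f -> V (g x) -> (forall y, is_diff y g l) ->
  'd (fun y => 'd (fun y => f (g y)) y u) x v =
  'd (fun z => 'd f z (l u)) (g x) (l v).
Proof.
move=> oV Cf Vx dg.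
have nV : \forall y \near x, V (g y).
  have : {for x, continuous g} by apply: differentiable_continuous; exact: ex_diff.
  by apply; exact: open_nbhs_nbhs.
have df2 : differentiable (fun z => 'd f z (l u) : R^o) (g x).
  exact: Ck1_diff (Ck_diff (l u) oV Cf) Vx.
have ne : \forall y \near x, 'd f (g y) (l u) = 'd (fun y => f (g y)) y u :> R^o.
  apply: filterS nV => y Vy; rewrite (diff_affine u (dg y)) //.
  exact: Ck1_diff Cf Vy.
rewrite -(diff_affine v (dg x) df2); apply/esym; move: v; apply/funeqP.
apply: near_diffE ne _; apply: (differentiable_comp (f := g)) df2.
exact: ex_diff.
Qed.

(** By linearity the direction splits into [(u, 0)], which moves the base point, and [(0, w)], along
    which the map is the linear ['d f x]. *)
Lemma diff_uncurried E F (U : set E) (f : E -> F) x v u w :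
  open U -> Ck 2 U f -> U x ->
  'd (fun z : E * E => 'd f (z.1) z.2) (x, v) (u, w) =
  'd (fun y => 'd f y v) x u + 'd f x w.
Proof.
move=> oU Cf Ux; have [df [dD _]] := Cf.
have dP : differentiable (fun z : E * E => 'd f (z.1) z.2) (x, v).
  exact: dD.
have -> : (u, w) = (u, 0) + (0, w) by congr pair; rewrite /= ?addr0 ?add0r.
rewrite linearD; congr (_ + _).
  have dg : is_diff x (fun y : E => (y, v)) (fun u => (u, 0)).
    exact: (is_diff_pair (is_diff_id x) (is_diff_cst v x)).
  by rewrite (diff_affine (g := fun y => (y, v)) u dg dP).
have dg : is_diff v (fun y : E => (x, y)) (fun w => (0, w)).
  exact: (is_diff_pair (is_diff_cst x v) (is_diff_id v)).
rewrite -(diff_affine (g := fun y => (x, y)) w dg dP) /= diff_lin //.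
exact/diff_continuous/df.
Qed.

End DerivativeFormulas.

(** * Covariance of the Euler-Lagrange form *)

Section EulerLagrange.
Context {R : realType} {n : nat}.
Local Notation E := 'rV[R]_n.

(** The tangent map of [tau]; when [tau] changes charts of [Q], this changes the natural charts of
    the tangent bundle. *)
Definition tangent_lift (tau : E -> E) (z : E * E) : E * E :=
  (tau z.1, 'd tau (z.1) z.2).

(** The two sums of second derivatives in the Euler-Lagrange form are merged into one derivative of
    the momentum component, along [(z.2, a)]: the direction of a second-order vector at [z] with
    acceleration [a]. *)
Definition euler_lagrange (g : E * E -> R^o) (z : E * E) (a : E) : 'cV[R]_n :=
  \col_i ('d g z (delta_mx 0 i, 0) -
          'd (fun y => 'd g y (0, delta_mx 0 i)) z (z.2, a)).

Lemma linear_split (A B : {linear (E * E)%type -> R^o}) :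
  linear (fun v : E => A (v, 0) - B (0, v) : R^o).
Proof.
move=> k v w.
have -> : (k *: v + w, 0 : E) = k *: (v, 0) + (w, 0).
  by congr pair; rewrite /= scaler0 addr0.
have -> : (0 : E, k *: v + w) = k *: (0, v) + (0, w).
  by congr pair; rewrite /= scaler0 addr0.
by rewrite (linearP A) (linearP B) scalerBr opprD addrACA.
Qed.

(** In the second term [u] sits under the outer derivative. Symmetry of second derivatives brings it
    outside, where linearity in [u] is visible and the components add up. *)
Lemma pair_euler_lagrange (U : set (E * E)) (g : E * E -> R^o) z a u :
  open U -> U z -> Ck 2 U g ->
  pair_cov (euler_lagrange g z a) u =
  'd g z (u, 0) - 'd (fun y => 'd g y (0, u)) z (z.2, a) :> R.
Proof.
move=> oU Uz Cg.
pose A := 'd g z.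
pose B := 'd (fun y => 'd g y (z.2, a)) z.
have sym v : 'd (fun y => 'd g y (0, v)) z (z.2, a) = B (0, v) :> R.
  exact: (second_derivative_symmetric (0, v) (z.2, a) oU Uz Cg).
pose f v : R^o := A (v, 0) - B (0, v).
have lf : linear f by exact: linear_split.
transitivity (f u); last by congr (_ - _); exact/esym/sym.
rewrite -(pair_cov_col u lf); congr (pair_cov _ u); apply/colP => i.
by rewrite !mxE; congr (_ - _); exact: sym.
Qed.

Lemma row_second_derivative_symmetric m (U : set E) (f : E -> 'rV[R]_m) x u v :
  open U -> U x -> Ck 2 U f ->
  'd (fun z => 'd f z u) x v = 'd (fun z => 'd f z v) x u.
Proof.
move=> oU Ux Cf; apply/pair_cov_injr => a.
have la := pair_cov_linear a.
have ca := mx_linear_continuous la.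
have df z : U z -> differentiable f z by move=> Uz; exact: Ck1_diff Cf Uz.
have d2 w w' : pair_cov a ('d (fun z => 'd f z w) x w') =
   'd (fun z => 'd (fun y => pair_cov a (f y) : R^o) z w) x w' :> R.
  have d2f : differentiable (fun z => 'd f z w) x.
    exact: Ck1_diff (Ck_diff w oU Cf) Ux.
  rewrite -(diff_lincomp w' la ca d2f); move: w'; apply/funeqP.
  apply: near_diffE.
    near=> z; rewrite (diff_lincomp w la ca) //; apply: df; near: z.
    exact: open_nbhs_nbhs.
  apply: (differentiable_comp (g := pair_cov a : _ -> R^o)) d2f _.
  by have dl := linear_is_diff ('d f x w) la ca; exact: ex_diff.
rewrite !d2; apply: (second_derivative_symmetric _ _ oU Ux).
pose fM := GRing.isLinear.Build _ _ _ _ _ la.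
pose fL : {linear 'rV[R]_m -> R^o} := HB.pack (pair_cov a : _ -> R^o) fM.
exact: (Ck_linear (g := fL) oU ca Cf).
Unshelve. all: by end_near. Qed.

Lemma Ck_tangent_lift k (V : set E) (tau : E -> E) :
  open V -> Ck k.+1 V tau -> Ck k (V `*` setT) (tangent_lift tau).
Proof.
move=> oV Ct; have oV' := open_prodT (F := E) oV.
have [dt CDt] := Ct.
apply: Ck_pair => //; apply: (Ck_comp (V := V) (f := fst)) (CkS Ct) => //.
  by case=> ? ? [].
exact: Ck_fst.
Qed.

Lemma diff_tangent_lift (V : set E) (tau : E -> E) x y u w :
  open V -> V x -> Ck 2 V tau ->
  'd (tangent_lift tau) (x, y) (u, w) =
  ('d tau x u, 'd (fun z => 'd tau z y) x u + 'd tau x w).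
Proof.
move=> oV Vx Ct; have [dt [dD _]] := Ct.
have dfst : is_diff (x, y) (fst : E * E -> E) fst.
  by apply: linear_is_diff => // z; exact: cvg_fst.
have d1 : differentiable (fun z : E * E => tau z.1) (x, y).
  by apply: (differentiable_comp (f := fst)); [exact: ex_diff | exact: dt].
have d2 : differentiable (fun z : E * E => 'd tau (z.1) z.2) (x, y) by exact: dD.
rewrite /tangent_lift (diff_pair d1 d2); congr (_, _).
  exact: (diff_affine (g := fst) (u, w) dfst (dt _ Vx)).
exact: (diff_uncurried y u w oV Ct Vx).
Qed.

(** Besides its covariant part, each of the two terms of the form of [g'] produces the same
    non-tensorial term ['d g T0 (0, S)], where [S] is the second derivative of [tau] along [y] and
    [u]; these cancel. Three derivatives of [tau] make [tangent_lift tau] of class [Ck 2]. *)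
Lemma euler_lagrange_lift (V : set E) (tau : E -> E) (W : set (E * E))
    (g g' : E * E -> R^o) x y a u :
  open V -> V x -> Ck 3 V tau -> open W -> Ck 2 W g ->
  (forall z, V z.1 -> W (tangent_lift tau z)) ->
  (forall z, V z.1 -> g' z = g (tangent_lift tau z)) ->
  pair_cov (euler_lagrange g' (x, y) a) u =
  pair_cov (euler_lagrange g (tangent_lift tau (x, y))
              ('d (tangent_lift tau) (x, y) (y, a)).2) ('d tau x u).
Proof.
move=> oV Vx Ct oW Cg VW g'E; have Ct2 := CkS Ct.
have CT := Ck_tangent_lift oV Ct.
have oV' := open_prodT (F := E) oV.
have CgT : Ck 2 (V `*` setT) (g \o tangent_lift tau).
  by apply: Ck_comp CT Cg => // z [/VW].
have Cg' : Ck 2 (V `*` setT) g'.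
  by apply: Ck_eq CgT => // z [/g'E].
have Vxy : (V `*` setT) (x, y) by [].
apply: etrans (pair_euler_lagrange a u oV' Vxy Cg') _.
apply: etrans _ (esym (pair_euler_lagrange _ _ oW (VW (x, y) Vx) Cg)).
have dT z : V z.1 -> differentiable (tangent_lift tau) z.
  by move=> Vz; apply: (Ck1_diff CT).
have dg z : V z.1 -> differentiable g (tangent_lift tau z).
  by move=> Vz; apply: (Ck1_diff Cg (VW z Vz)).
have nV (z : E * E) : V z.1 -> \forall y \near z, (V `*` setT) y.
  by move=> Vz; exact: (@open_nbhs_nbhs _ z (V `*` setT) (conj oV' (conj Vz I))).
have dg' z w : V z.1 -> 'd g' z w = 'd g (tangent_lift tau z) ('d (tangent_lift tau) z w).
  move=> Vz; transitivity ('d (g \o tangent_lift tau) z w).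
    move: w; apply/funeqP; apply: near_diffE; last first.
      by apply: (Ck1_diff Cg').
    by apply: filterS (nV z Vz) => p [/g'E].
  exact: (diff_compE w (dT z Vz) (dg z Vz)).
have CtauU : Ck 2 V (fun z => 'd tau z u) by exact: Ck_diff.
have dfst : is_diff (x, y) (fst : E * E -> E) fst.
  by apply: linear_is_diff => // z; exact: cvg_fst.
have dtauU : differentiable (fun z => 'd tau z u) x by exact: Ck1_diff CtauU Vx.
have dtu : differentiable (fun z : E * E => 'd tau (z.1) u) (x, y).
  by apply: (differentiable_comp (f := fst) (g := fun z => 'd tau z u)).
have d0u : differentiable (fun z : E * E => (0 : E, 'd tau (z.1) u)) (x, y).
  by apply: differentiable_pair => //; exact: differentiable_cst.
(* [Phi z] is the image of the vertical vector [(0, u)] at [z] under the tangent map of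
   [tangent_lift tau]. Hence [z |-> 'd g' z (0, u)] is the uncurried differential of [g] after
   [Phi], and [diff_uncurried] separates the two ways in which it varies. *)
pose Phi z := (tangent_lift tau z, (0 : E, 'd tau (z.1) u)).
have dPhi : differentiable Phi (x, y).
  by apply: differentiable_pair => //; exact: dT.
have [_ [dDg _]] := Cg.
have dDgPhi : differentiable (fun p => 'd g (p.1) p.2) (Phi (x, y)).
  by apply: dDg; split => //; exact: VW.
pose S := 'd (fun z => 'd tau z u) x y.
pose T0 := tangent_lift tau (x, y).
pose T1 := 'd (tangent_lift tau) (x, y) (y, a).
have first_term : 'd g' (x, y) (u, 0) = 'd g T0 ('d tau x u, 0) + 'd g T0 (0, S).
  apply: etrans (dg' (x, y) (u, 0) Vx) _.
  apply: etrans (linearD ('d g T0) _ _); apply: (congr1 ('d g T0)).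
  apply: etrans (diff_tangent_lift y u 0 oV Vx Ct2) _.
  have e1 := row_second_derivative_symmetric y u oV Vx Ct2.
  have e2 : 'd tau x 0 = 0 := linear0 ('d tau x).
  congr (_, _); first exact/esym/addr0.
  apply: etrans (congr2 +%R e1 e2) _.
  exact: (etrans (addr0 _) (esym (add0r _))).
have second_term : 'd (fun z => 'd g' z (0, u)) (x, y) (y, a) =
    'd (fun z => 'd g z (0, 'd tau x u)) T0 T1 + 'd g T0 (0, S).
  transitivity ('d ((fun p => 'd g (p.1) p.2) \o Phi) (x, y) (y, a)).
    move: (y, a) => /=; apply/funeqP/esym; apply: near_diffE; last first.
      exact: differentiable_comp.
    apply: filterS (nV (x, y) Vx) => -[p q] [/= Vp _].
    apply/esym/(etrans (dg' (p, q) (0, u) Vp)).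
    apply: (congr1 ('d g (tangent_lift tau (p, q)))).
    apply: etrans (diff_tangent_lift q 0 u oV Vp Ct2) _.
    have e1 : 'd (fun z => 'd tau z q) p 0 = 0 := linear0 _.
    have e2 : 'd tau p 0 = 0 := linear0 ('d tau p).
    congr (_, _); first exact: e2.
    exact: (etrans (congr2 +%R e1 erefl) (add0r _)).
  apply: etrans (diff_compE (y, a) dPhi dDgPhi) _.
  have -> : 'd Phi (x, y) (y, a) = (T1, (0, S)).
    apply: etrans (diff_pairE (y, a) (dT (x, y) Vx) d0u) _; congr (_, _).
    apply: etrans (diff_pairE (y, a) (differentiable_cst (0 : E) (x, y)) dtu) _.
    congr (_, _); first by rewrite (diff_cst (0 : E)).
    exact: (diff_affine (g := fst) (f := fun z => 'd tau z u) (y, a) dfst dtauU).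
  exact: (diff_uncurried _ _ _ oW Cg (VW (x, y) Vx)).
apply: etrans (congr2 (fun p q => p - q) first_term second_term) _.
rewrite /= opprD addrACA subrr addr0.
congr (_ - _); congr (GRing.Linear.sort _ _).
(* What remains is that the first component of [T1] is the second one of [T0]: the tangent map
   preserves the second-order condition. *)
rewrite [LHS]surjective_pairing; congr (_, _).
by rewrite /T1 (diff_tangent_lift y y a oV Vx Ct2).
Qed.

End EulerLagrange.

(** * Differentiation along the fibres *)

Section FibreDerivative.
Context {R : realType}.

Lemma is_diff_sum (E F : normedModType R) m (f : 'I_m -> E -> F) x :
  (forall i, differentiable (f i) x) ->
  is_diff x (fun y => \sum_i f i y) (fun u => \sum_i 'd (f i) x u).
Proof.
move=> df; elim: (index_enum 'I_m) => [|i s IH].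
  under eq_fun do rewrite big_nil.
  under [X in is_diff_def _ _ X]eq_fun do rewrite big_nil.
  exact: is_diff_cst.
under eq_fun do rewrite big_cons.
under [X in is_diff_def _ _ X]eq_fun do rewrite big_cons.
exact: (is_diffD (differentiableP (df i)) IH).
Qed.

Variable n : nat.

(** With the base point frozen, [fibD] and [cofibD] become [row_grad] and [col_grad] on a single
    fibre. Their differentials are Hessians, from vectors to covectors for the first and from
    covectors to vectors for the second. *)
Definition row_grad (f : 'rV[R]_n -> R^o) (w : 'rV[R]_n) : 'cV[R]_n :=
  \col_i 'd f w (delta_mx 0 i).

Definition col_grad (h : 'cV[R]_n -> R^o) (a : 'cV[R]_n) : 'rV[R]_n :=
  \row_i 'd h a (delta_mx i 0).

Lemma pair_row_grad f w u : pair_cov (row_grad f w) u = 'd f w u :> R.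
Proof. by apply: pair_cov_col; exact: linearP. Qed.

Lemma pair_col_grad h a b : pair_cov b (col_grad h a) = 'd h a b :> R.
Proof. by apply: pair_cov_row; exact: linearP. Qed.

Lemma Ck_row_grad k (U : set 'rV[R]_n) f :
  open U -> Ck k.+1 U f -> Ck k U (row_grad f).
Proof.
move=> oU Cf.
have C : Ck k U (fun w =>
    \sum_i ('d f w (delta_mx 0 i) : R^o) *: (delta_mx i 0 : 'cV[R]_n)).
  by apply: Ck_sum => // i; apply: Ck_scalel => //; exact: Ck_diff.
apply: Ck_eq C => // w _; rewrite [RHS](col_sumE (row_grad f w)).
by apply: eq_bigr => i _; rewrite mxE.
Qed.

Lemma Ck_col_grad k (U : set 'cV[R]_n) h :
  open U -> Ck k.+1 U h -> Ck k U (col_grad h).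
Proof.
move=> oU Ch.
have C : Ck k U (fun a =>
    \sum_i ('d h a (delta_mx i 0) : R^o) *: (delta_mx 0 i : 'rV[R]_n)).
  by apply: Ck_sum => // i; apply: Ck_scalel => //; exact: Ck_diff.
apply: Ck_eq C => // a _; rewrite [RHS](row_sumE (col_grad h a)).
by apply: eq_bigr => i _; rewrite mxE.
Qed.

Lemma pair_diff_row_grad (U : set 'rV[R]_n) f w b u :
  open U -> Ck 2 U f -> U w ->
  pair_cov ('d (row_grad f) w b) u = 'd (fun w => 'd f w u) w b :> R.
Proof.
move=> oU Cf Uw; have lu := pair_cov_linearl u.
have dF : differentiable (row_grad f) w by exact: Ck1_diff (Ck_row_grad oU Cf) Uw.
rewrite -(diff_lincomp b lu (mx_linear_continuous lu) dF).
by under eq_fun do rewrite pair_row_grad.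
Qed.

Lemma pair_diff_col_grad (U : set 'cV[R]_n) h a b c :
  open U -> Ck 2 U h -> U a ->
  pair_cov c ('d (col_grad h) a b) = 'd (fun a => 'd h a c) a b :> R.
Proof.
move=> oU Ch Ua; have lc := pair_cov_linear c.
have dG : differentiable (col_grad h) a by exact: Ck1_diff (Ck_col_grad oU Ch) Ua.
rewrite -(diff_lincomp b lc (mx_linear_continuous lc) dG).
by under eq_fun do rewrite pair_col_grad.
Qed.

Lemma hessian_symmetric (U : set 'rV[R]_n) f w b u :
  open U -> Ck 2 U f -> U w ->
  pair_cov ('d (row_grad f) w b) u = pair_cov ('d (row_grad f) w u) b.
Proof.
move=> oU Cf Uw; rewrite !(pair_diff_row_grad _ _ oU Cf Uw).
exact: second_derivative_symmetric Cf.
Qed.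

Lemma cohessian_symmetric (U : set 'cV[R]_n) h a b c :
  open U -> Ck 2 U h -> U a ->
  pair_cov c ('d (col_grad h) a b) = pair_cov b ('d (col_grad h) a c).
Proof.
move=> oU Ch Ua; rewrite !(pair_diff_col_grad _ _ oU Ch Ua).
exact: second_derivative_symmetric Ch.
Qed.

(** The composite of [phi] with [row_grad l] vanishes on an open set, and the chain rule writes its
    zero derivative as this pairing. So the gradient of a constraint annihilates the whole image of
    the Hessian. *)
Lemma constraint_hessian (Om : set 'rV[R]_n) (Up : set 'cV[R]_n) l phi y b :
  open Om -> Om y -> Ck 2 Om l -> Ck 1 Up phi ->
  (forall w, Om w -> Up (row_grad l w) /\ phi (row_grad l w) = 0) ->
  pair_cov ('d (row_grad l) y b) (col_grad phi (row_grad l y)) = 0.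
Proof.
move=> oOm Omy Cl Cphi phi0.
have dF : differentiable (row_grad l) y by exact: Ck1_diff (Ck_row_grad oOm Cl) Omy.
have dphi : differentiable phi (row_grad l y) by exact: Ck1_diff Cphi (phi0 y Omy).1.
rewrite pair_col_grad -(diff_compE b dF dphi).
rewrite -(near_diffE (f := fun=> 0 : R^o)) ?(diff_cst (0 : R^o)) //.
  by apply: filterS (open_nbhs_nbhs (conj oOm Omy)) => w /phi0[_ /esym].
Qed.

(** The resolution paired with the constant [delta] is a scalar identity in [w]. Its derivative
    along [u], after the symmetry of the Hessians of [l], [H] and [phi mu] has moved the arguments,
    is the claim paired with [u]. By the product rule, the right-hand side collects the terms in
    which [lambda mu] is differentiated. *)
Lemma resolution_hessian (Om : set 'rV[R]_n) (Up : set 'cV[R]_n) l H m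
    (phi : 'I_m -> 'cV[R]_n -> R^o) (lambda : 'I_m -> 'rV[R]_n -> R^o) y delta :
  open Om -> Om y -> open Up -> Ck 2 Om l -> Ck 2 Up H ->
  (forall mu, Ck 2 Up (phi mu)) -> (forall mu, Ck 1 Om (lambda mu)) ->
  (forall w, Om w -> Up (row_grad l w)) ->
  (forall w, Om w -> w = col_grad H (row_grad l w) +
     \sum_mu lambda mu w *: col_grad (phi mu) (row_grad l w)) ->
  delta - 'd (row_grad l) y ('d (col_grad H) (row_grad l y) delta +
    \sum_mu lambda mu y *: 'd (col_grad (phi mu)) (row_grad l y) delta) =
  \sum_mu pair_cov delta (col_grad (phi mu) (row_grad l y)) *: row_grad (lambda mu) y.
Proof.
move=> oOm Omy oUp Cl CH Cphi Clam OmUp res.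
set p := row_grad l y; have Upp : Up p by exact: OmUp.
have dF : differentiable (row_grad l) y by exact: Ck1_diff (Ck_row_grad oOm Cl) Omy.
have dh (h : 'cV[R]_n -> R^o) : Ck 2 Up h -> differentiable (fun a => 'd h a delta : R^o) p.
  by move=> Ch; exact: Ck1_diff (Ck_diff delta oUp Ch) Upp.
have dhF (h : 'cV[R]_n -> R^o) : Ck 2 Up h ->
    differentiable (fun w => 'd h (row_grad l w) delta : R^o) y.
  by move=> /dh d; exact: (differentiable_comp dF d).
have dhFE (h : 'cV[R]_n -> R^o) u : Ck 2 Up h ->
    'd (fun w => 'd h (row_grad l w) delta : R^o) y u =
    pair_cov ('d (row_grad l) y u) ('d (col_grad h) p delta) :> R.
  move=> Ch; apply: etrans (diff_compE u dF (dh _ Ch)) _.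
  by rewrite (cohessian_symmetric _ _ oUp Ch Upp) (pair_diff_col_grad _ _ oUp Ch Upp).
have dlam mu : differentiable (lambda mu) y by exact: Ck1_diff (Clam mu) Omy.
pose S mu w : R^o := lambda mu w * 'd (phi mu) (row_grad l w) delta.
have dS mu : differentiable (S mu) y.
  exact: (differentiableM (dlam mu) (dhF _ (Cphi mu))).
apply: pair_cov_inj => u; apply/eqP.
(* Moving the Hessian of [l] onto [u] isolates [pair_cov delta u], the derivative along [u] of
   [w |-> pair_cov delta w]. *)
rewrite pair_covDl pair_covNl (hessian_symmetric _ _ oOm Cl Omy) subr_eq; apply/eqP.
have ld := pair_cov_linear delta.
have d_id : is_diff y (fun w => pair_cov delta w : R^o) (pair_cov delta).
  exact: mx_linear_is_diff.
rewrite -[LHS](congr1 (fun h => h u) (@diff_val _ _ _ _ _ _ _ d_id)).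
transitivity ('d (fun w => ('d H (row_grad l w) delta : R^o) + \sum_mu S mu w) y u).
  move: u; apply/funeqP; apply: near_diffE; last exact: ex_diff.
  apply: filterS (open_nbhs_nbhs (conj oOm Omy)) => w Omw.
  rewrite [in LHS](res w Omw) pair_covD pair_cov_sum pair_col_grad; congr (_ + _).
  by apply: eq_bigr => mu _; rewrite pair_covZ pair_col_grad.
have dHD := is_diffD (differentiableP (dhF H CH)) (is_diff_sum dS).
rewrite [LHS](congr1 (fun h => h u) (@diff_val _ _ _ _ _ _ _ dHD)).
rewrite pair_covD pair_cov_sum pair_cov_suml [RHS]addrCA; congr (_ + _).
  exact: dhFE.
rewrite -big_split; apply: eq_bigr => mu _ /=.
rewrite pair_covZ pair_covZl pair_row_grad pair_col_grad.
apply: etrans (congr1 (fun h => h u) (diffM (dlam mu) (dhF _ (Cphi mu)))) _.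
apply: etrans (addrC _ _) _; apply: (congr2 +%R) => //.
exact: (congr1 ( *%R (lambda mu y)) (dhFE _ u (Cphi mu))).
Qed.

End FibreDerivative.

(** * Charts of the tangent and cotangent bundles *)

Section Charts.
Context {R : realType} {n : nat} {Q : charted 'rV[R]_n}.
Hypothesis hQ : smooth_manifold Q.
Implicit Types (b c d : chart Q) (q : Q).
Local Notation E := 'rV[R]_n.

Definition overlap b c : set E := ccod b `&` param b @^-1` cdom c.

Definition transition b c : E -> E := ccoord c \o param b.

Definition jac b c q : E -> E := 'd (transition b c) (ccoord b q).

(** The transpose of [jac b c q]; it therefore goes the other way, from components in [c] to
    components in [b]. *)
Definition cojac b c q : 'cV[R]_n -> 'cV[R]_n := pullback (transition b c) (ccoord b q).

Lemma overlap_open b c : open (overlap b c). Proof. exact: (mf_open hQ). Qed.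

Lemma overlap_coord b c q : cdom b q -> cdom c q -> overlap b c (ccoord b q).
Proof. by move=> bq cq; split; [exact: mf_coord | rewrite /= (mf_coordK hQ)]. Qed.

Lemma Ck_transition k b c : Ck k (overlap b c) (transition b c).
Proof. exact: (mf_smooth hQ). Qed.

Lemma differentiable_transition b c x :
  overlap b c x -> differentiable (transition b c) x.
Proof. exact: Ck1_diff (Ck_transition 1 b c). Qed.

Lemma transition_comp b c d x w : overlap b c x -> overlap b d x ->
  'd (transition c d) (transition b c x) ('d (transition b c) x w) =
  'd (transition b d) x w.
Proof.
move=> bc bd.
have cd : overlap c d (transition b c x).
  by apply: overlap_coord; [exact: bc.2 | exact: bd.2].
have dbc := differentiable_transition bc.
apply: etrans (esym (diff_compE w dbc (differentiable_transition cd))) _.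
move: w; apply/funeqP; apply: near_diffE.
  apply: filterS (open_nbhs_nbhs (conj (@overlap_open b c) bc)) => y bcy.
  by rewrite /transition /= (mf_coordK hQ) //; exact: bcy.2.
by apply: differentiable_comp; exact: differentiable_transition.
Qed.

Lemma jac_comp b c d q w : cdom b q -> cdom c q -> cdom d q ->
  jac c d q (jac b c q w) = jac b d q w.
Proof.
move=> bq cq dq; apply: etrans (transition_comp w (overlap_coord bq cq) (overlap_coord bq dq)).
by rewrite /jac /transition [(_ \o _) (ccoord b q)]/= (mf_coordK hQ).
Qed.

Lemma jac_id b q w : cdom b q -> jac b b q w = w.
Proof. exact: change_id. Qed.

Lemma jacK b c q w : cdom b q -> cdom c q -> jac c b q (jac b c q w) = w.
Proof. by move=> bq cq; rewrite jac_comp // jac_id. Qed.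

Lemma pair_cojac b c q a w : pair_cov (cojac b c q a) w = pair_cov a (jac b c q w).
Proof.
apply: (pair_cov_col (f := fun w => pair_cov a (jac b c q w))) => k u v.
by rewrite /jac linearP pair_cov_linear.
Qed.

Lemma cojac_linear b c q : linear (cojac b c q).
Proof.
move=> k a1 a2; apply: pair_cov_inj => w.
by rewrite pair_cojac pair_cov_linearl pair_covDl pair_covZl !pair_cojac.
Qed.

Lemma cojacK b c q a : cdom b q -> cdom c q -> cojac b c q (cojac c b q a) = a.
Proof. by move=> bq cq; apply: pair_cov_inj => w; rewrite !pair_cojac jacK. Qed.

Lemma cojac_id b q a : cdom b q -> cojac b b q a = a.
Proof. by move=> bq; apply: pair_cov_inj => w; rewrite pair_cojac jac_id. Qed.

Lemma tangent_paramE c q w : cdom c q ->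
  param (c : chart (tangent Q)) (ccoord c q, jac (chart_at q) c q w) = TVec q w.
Proof.
move=> cq; rewrite /= (mf_coordK hQ) //; congr TVec.
by rewrite -[LHS]/(jac c (chart_at q) q _) jacK //; exact: (mf_chart_at hQ).
Qed.

Lemma cotangent_paramE c q a : cdom c q ->
  param (c : chart (cotangent Q)) (ccoord c q, cojac c (chart_at q) q a) = CVec q a.
Proof.
move=> cq; rewrite /= (mf_coordK hQ) //; congr CVec.
by rewrite -[LHS]/(cojac (chart_at q) c q _) cojacK //; exact: (mf_chart_at hQ).
Qed.

Lemma smooth_fun_local (F : normedModType R) (M : charted F) (A : set M)
    (f : M -> R) (c : chart M) :
  smooth_fun A f -> open (ccod c `&` param c @^-1` A) /\
  forall k, Ck k (ccod c `&` param c @^-1` A) (f \o param c : F -> R^o).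
Proof.
move=> /(_ c tt) /=; rewrite preimage_setT setIT => -[oV CV].
by split => // k; exact: CV.
Qed.

Lemma Ck_pairr k (E1 E2 : normedModType R) (U : set E2) (x : E1) :
  open U -> Ck k U (fun w : E2 => (x, w)).
Proof.
move=> oU; apply: Ck_pair => //; first exact: Ck_cst.
exact: Ck_id.
Qed.

(** In the chart chosen at [q], stored components and coordinates coincide, so the fibre over [q] is
    a coordinate slice. Openness and smoothness on [A] then restrict to the fibre by composition
    with [w |-> (x, w)]. *)
Lemma fibre_preimage (A : set (tangent Q)) q :
  [set w | A (TVec q w)] = pair (ccoord (chart_at q) q) @^-1`
    (tcod (chart_at q) `&` param (chart_at q : chart (tangent Q)) @^-1` A).
Proof.
have bq := mf_chart_at hQ q.
have pE w : param (chart_at q : chart (tangent Q)) (ccoord (chart_at q) q, w) = TVec q w.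
  by rewrite -(tangent_paramE w bq) jac_id.
apply/seteqP; split => [w Aw|w [_ Aw]].
  by split; [split => //; exact: (mf_coord hQ) | rewrite /preimage /mkset pE].
by move: Aw; rewrite /preimage /mkset pE.
Qed.

Lemma fibre_open (A : set (tangent Q)) q : open A -> open [set w | A (TVec q w)].
Proof.
move=> oA; rewrite fibre_preimage; apply: open_comp; last exact: oA.
by move=> w _; apply: (Ck_pairr 0 _ openT).
Qed.

Lemma fibre_smooth k (A : set (tangent Q)) (f : tangent Q -> R) q :
  open A -> smooth_fun A f ->
  Ck k [set w | A (TVec q w)] (fun w => f (TVec q w) : R^o).
Proof.
move=> oA /(smooth_fun_local (chart_at q : chart (tangent Q)))[_ Cf].
have bq := mf_chart_at hQ q; have oAq := fibre_open (q := q) oA.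
apply: Ck_eq (Ck_comp oAq _ (Ck_pairr k (ccoord (chart_at q) q) oAq) (Cf k)) => //.
  by move=> w _; rewrite /= -[in RHS](tangent_paramE w bq) jac_id.
by move=> w; rewrite fibre_preimage.
Qed.

Lemma cofibre_preimage (A : set (cotangent Q)) q :
  [set a | A (CVec q a)] = pair (ccoord (chart_at q) q) @^-1`
    (ctcod (chart_at q) `&` param (chart_at q : chart (cotangent Q)) @^-1` A).
Proof.
have bq := mf_chart_at hQ q.
have pE a : param (chart_at q : chart (cotangent Q)) (ccoord (chart_at q) q, a) = CVec q a.
  by rewrite -(cotangent_paramE a bq) cojac_id.
apply/seteqP; split => [a Aa|a [_ Aa]].
  by split; [split => //; exact: (mf_coord hQ) | rewrite /preimage /mkset pE].
by move: Aa; rewrite /preimage /mkset pE.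
Qed.

Lemma cofibre_open (A : set (cotangent Q)) q : open A -> open [set a | A (CVec q a)].
Proof.
move=> oA; rewrite cofibre_preimage; apply: open_comp; last exact: oA.
by move=> a _; apply: (Ck_pairr 0 _ openT).
Qed.

Lemma cofibre_smooth k (A : set (cotangent Q)) (h : cotangent Q -> R) q :
  open A -> smooth_fun A h ->
  Ck k [set a | A (CVec q a)] (fun a => h (CVec q a) : R^o).
Proof.
move=> oA /(smooth_fun_local (chart_at q : chart (cotangent Q)))[_ Cf].
have bq := mf_chart_at hQ q; have oAq := cofibre_open (q := q) oA.
apply: Ck_eq (Ck_comp oAq _ (Ck_pairr k (ccoord (chart_at q) q) oAq) (Cf k)) => //.
  by move=> a _; rewrite /= -[in RHS](cotangent_paramE a bq) cojac_id.
by move=> a; rewrite cofibre_preimage.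
Qed.

End Charts.

Lemma linear_pair_split (R : realType) (E F : normedModType R)
  (D : {linear (E * F)%type -> R^o}) u v : D (u, 0) + D (0, v) = D (u, v).
Proof.
by rewrite -linearD; congr (D (_, _)); rewrite /= ?addr0 ?add0r.
Qed.

(** * The Euler-Lagrange form at one point and its dependence on the acceleration *)

Section Lagrangian.
Context {R : realType} {n : nat} {Q : charted 'rV[R]_n}.
Hypothesis hQ : smooth_manifold Q.
Variable L : tangent Q -> R.
Hypothesis L_smooth : smooth_fun setT L.
Local Notation E := 'rV[R]_n.

Definition local_lagrangian (c : chart Q) : E * E -> R^o :=
  L \o param (c : chart (tangent Q)).

Lemma Ck_local_lagrangian k (c : chart Q) : Ck k (tcod c) (local_lagrangian c).
Proof.
have [_ /(_ k)] := smooth_fun_local (c : chart (tangent Q)) L_smooth.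
by rewrite preimage_setT setIT.
Qed.

(** Swapping the iterated partial derivatives puts [dv i] innermost; the sums over [j] then become
    one differential evaluated on the vector [(z.2, a)]. *)
Lemma deltaLE (X : tangent (tangent Q)) :
  vfib (deltaL L X) =
  euler_lagrange (local_lagrangian (chart_at (tbase (tbase X))))
    (ccoord (chart_at (tbase X)) (tbase X)) (tfib X).2.
Proof.
set c := chart_at (tbase (tbase X)); set z := ccoord _ _; set a := (tfib X).2.
have Uz : tcod c z by split => //; apply: (mf_coord hQ); exact: (mf_chart_at hQ).
have oU : open (tcod c) by exact: tcod_open.
have Cg := Ck_local_lagrangian 2 c.
set g := local_lagrangian c in Cg *.
have dg y : tcod c y -> differentiable g y by move=> Uy; exact: Ck1_diff Cg Uy.
have d2 (e e' : E * E) : 'D_e ('D_e' g) z = 'd (fun y => 'd g y e) z e' :> R.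
  transitivity ('D_e (fun y => 'd g y e' : R^o) z).
    apply: near_eq_derive; apply: filterS (open_nbhs_nbhs (conj oU Uz)) => y Uy.
    by rewrite deriveE //; exact: dg.
  rewrite deriveE; last exact: Ck1_diff (Ck_diff e' oU Cg) Uz.
  exact: (second_derivative_symmetric e' e oU Uz Cg).
apply/colP => i; rewrite [RHS]mxE [LHS]mxE.
rewrite -/g -/z; set D := 'd (fun y => 'd g y (0, delta_mx 0 i)) z.
have sumD (w : E) (h : 'I_n -> E * E) (k : E -> E * E) :
    (forall j, k (delta_mx 0 j) = h j) -> linear k ->
    \sum_j 'D_(0, delta_mx 0 i) ('D_(h j) g) z * w 0 j = D (k w).
  move=> kh lk.
  have lDk : linear (fun v => D (k v) : R^o) by move=> r u v; rewrite lk linearP.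
  rewrite -(pair_cov_col w lDk) pair_covE; apply: eq_bigr => j _.
  by rewrite mulrC mxE d2 kh.
have l1 : linear (fun v : E => (v, 0 : E)).
  by move=> r u v; congr (_, _); rewrite /= scaler0 addr0.
have l2 : linear (fun v : E => (0 : E, v)).
  by move=> r u v; congr (_, _); rewrite /= scaler0 addr0.
rewrite /dv /dq (sumD z.2 _ _ (fun=> erefl) l1) (sumD a _ _ (fun=> erefl) l2).
rewrite deriveE; last exact: dg.
rewrite -addrA -opprD; congr (_ - _); exact: linear_pair_split.
Qed.

Definition fibre_lagrangian (q : Q) : E -> R^o := fun w => L (TVec q w).

Lemma Ck_fibre_lagrangian k (q : Q) : Ck k setT (fibre_lagrangian q).
Proof.
exact: (@fibre_smooth _ _ _ hQ k setT L q openT L_smooth).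
Qed.

(** Two vectors over the same point give directions [(z.2, a)] and [(z.2, a')] differing by the
    vertical [(0, a' - a)]. Along it the second derivative is taken within the fibre, so the linear
    part of [deltaL] is minus the fibre Hessian. *)
Lemma vfib_deltaL_add (X Y : tangent (tangent Q)) :
  tbase X = tbase Y ->
  vfib (deltaL L Y) = vfib (deltaL L X) -
    'd (row_grad (fibre_lagrangian (tbase (tbase X)))) (tfib (tbase X))
       ((tfib Y).2 - (tfib X).2).
Proof.
move=> XY; rewrite !deltaLE -XY.
set c := chart_at (tbase (tbase X)); set z := ccoord _ _.
set l := fibre_lagrangian _; set y := tfib (tbase X).
set a := (tfib X).2; set a' := (tfib Y).2.
have bq : cdom c (tbase (tbase X)) := mf_chart_at hQ _.
have Uz : tcod c z by split => //; apply: (mf_coord hQ).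
have zE : z = (ccoord c (tbase (tbase X)), y).
  by congr (_, _); exact: jac_id.
have oU : open (tcod c) by exact: tcod_open.
have Cg := Ck_local_lagrangian 2 c.
apply: pair_cov_inj => u; rewrite pair_covDl pair_covNl.
apply: etrans (pair_euler_lagrange a' u oU Uz Cg) _.
apply: etrans _ (esym (congr2 (fun p q => p - q) (pair_euler_lagrange a u oU Uz Cg) erefl)).
rewrite (pair_diff_row_grad _ _ openT (Ck_fibre_lagrangian 2 _) I).
pose g (w : E) := (ccoord c (tbase (tbase X)), w).
have dg w : is_diff w g (fun w => (0, w)).
  exact: (is_diff_pair (is_diff_cst _ w) (is_diff_id w)).
have lE : l = fun w => local_lagrangian c (g w).
  apply: funext => w; rewrite /l /fibre_lagrangian -(tangent_paramE hQ w bq).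
  by rewrite jac_id.
have -> : 'd (fun w => 'd l w u) y (a' - a) =
    'd (fun z => 'd (local_lagrangian c) z (0, u)) z (0, a' - a) :> R.
  have Ugy : tcod c (g y) by move: Uz; rewrite zE.
  by rewrite lE zE; exact: (diff2_affine u (a' - a) oU Cg Ugy dg).
set D := 'd (fun z => 'd (local_lagrangian c) z (0, u)) z.
rewrite -addrA -opprD; congr (_ - _).
apply/esym/(etrans (esym (linearD D _ _))).
by congr (D (_, _)); rewrite /= ?addr0 // addrC subrK.
Qed.

End Lagrangian.

(** * The identity for [D0] and the description of [V1] by the functions [chi] *)

Section PrimaryField.
Context {R : realType} {n : nat} {Q : charted 'rV[R]_n}.
Hypothesis hQ : smooth_manifold Q.
Variable L : tangent Q -> R.
Hypothesis L_smooth : smooth_fun setT L.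
Variables (U : set (cotangent Q)) (m : nat) (phi : 'I_m -> cotangent Q -> R).
Hypothesis U_open : open U.
Hypothesis phi_smooth : forall mu, smooth_fun U (phi mu).
Hypothesis phi0 : forall p, P0 L p -> U p -> forall mu, phi mu p = 0.
Variable H : cotangent Q -> R.
Hypothesis H_smooth : smooth_fun U H.
Variable Omega : set (tangent Q).
Hypothesis Omega_sub : Omega `<=` legendre L @^-1` U.
Variable lambda : 'I_m -> tangent Q -> R.
Hypothesis lambda_smooth : forall mu, smooth_fun Omega (lambda mu).
Hypothesis Omega_open : open Omega.
Hypothesis lambda_id : forall v, Omega v ->
  tfib v = gamma L H v + \sum_mu lambda mu v *: gamma L (phi mu) v.

Lemma hessian_resolution v delta : Omega v ->
  delta - 'd (row_grad (fibre_lagrangian L (tbase v))) (tfib v)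
            (Mop L H phi lambda v delta) =
  \sum_mu pair_cov delta (gamma L (phi mu) v) *: fibD (lambda mu) v.
Proof.
case: v => q y Ov; have oOm := fibre_open hQ (q := q) Omega_open.
apply: (resolution_hessian (Om := [set w | Omega (TVec q w)])
  (Up := [set a | U (CVec q a)])
  (phi := fun mu a => phi mu (CVec q a)) (H := fun a => H (CVec q a))
  (lambda := fun mu w => lambda mu (TVec q w))) => //.
- exact: (cofibre_open hQ).
- exact: Ck_sub (Ck_fibre_lagrangian hQ L_smooth 2 q).
- exact: (cofibre_smooth hQ).
- by move=> mu; exact: (cofibre_smooth hQ).
- by move=> mu; exact: (fibre_smooth hQ).
- by move=> w; exact: Omega_sub.
- by move=> w Ow; exact: lambda_id Ow.
Qed.

Lemma hessian_gamma v b mu : Omega v ->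
  pair_cov ('d (row_grad (fibre_lagrangian L (tbase v))) (tfib v) b)
    (gamma L (phi mu) v) = 0.
Proof.
case: v => q y Ov; have oOm := fibre_open hQ (q := q) Omega_open.
apply: (constraint_hessian (Om := [set w | Omega (TVec q w)])
  (Up := [set a | U (CVec q a)]) (phi := fun a => phi mu (CVec q a))) => //.
- exact: Ck_sub (Ck_fibre_lagrangian hQ L_smooth 2 q).
- exact: (cofibre_smooth hQ).
- move=> w Ow; split; first exact: Omega_sub Ow.
  by apply: phi0; [exists (TVec q w) | exact: Omega_sub Ow].
Qed.

Variable X0 : tangent Q -> tangent (tangent Q).
Hypothesis X0_base : forall v, tbase (X0 v) = v.
Hypothesis X0_second_order : forall v, second_order (X0 v).

Lemma chiE h v : chi L X0 h v = pair_cov (vfib (deltaL L (X0 v))) (gamma L h v).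
Proof. by rewrite /chi /Gamma vlE // /vpair. Qed.

Lemma D0E v : D0 L H phi lambda X0 v =
  TVec v (tfib (X0 v) + (0, Mop L H phi lambda v (vfib (deltaL L (X0 v))))).
Proof.
have e : vbase (deltaL L (X0 v)) = v := X0_base v.
rewrite /D0 /tadd /Mhat e X0_base (vlE hQ); exact: erefl.
Qed.

Lemma D0_second_order v : second_order (D0 L H phi lambda X0 v).
Proof.
rewrite D0E /second_order /= addr0; have := X0_second_order v.
by rewrite /second_order X0_base.
Qed.

Lemma deltaL_D0 v : Omega v ->
  deltaL L (D0 L H phi lambda X0 v) =
  VCov v (\sum_mu chi L X0 (phi mu) v *: fibD (lambda mu) v).
Proof.
move=> Ov.
suff e : vfib (deltaL L (D0 L H phi lambda X0 v)) =
    \sum_mu chi L X0 (phi mu) v *: fibD (lambda mu) v.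
  by rewrite -e D0E.
rewrite (vfib_deltaL_add hQ L_smooth (X := X0 v)); last by rewrite D0E X0_base.
rewrite X0_base D0E /= addrAC subrr add0r hessian_resolution //.
by apply: eq_bigr => mu _; rewrite chiE.
Qed.

(** If some [X] over [v] is killed by [deltaL], then the form of [X0] lies in the image of the fibre
    Hessian, which [hessian_gamma] pairs to zero with each constraint. Conversely, when all [chi]
    vanish, the formula for [D0] makes [D0] itself a witness for [V1]. *)
Lemma V1_chi v : Omega v -> V1 L v <-> forall mu, chi L X0 (phi mu) v = 0.
Proof.
move=> Ov; split=> [[X [Xv _ dX0]] mu|chi0].
  rewrite chiE (vfib_deltaL_add hQ L_smooth (X := X)) ?X0_base //.
  by rewrite dX0 sub0r pair_covNl Xv hessian_gamma // oppr0.
exists (D0 L H phi lambda X0 v); split; first by rewrite D0E.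
  exact: D0_second_order.
by rewrite deltaL_D0 //= big1 // => mu _; rewrite chi0 scale0r.
Qed.

End PrimaryField.

(** * Local expressions *)

Section LocalExpressions.
Context {R : realType} {n : nat} {Q : charted 'rV[R]_n}.
Hypothesis hQ : smooth_manifold Q.
Local Notation E := 'rV[R]_n.
Local Notation E' := 'cV[R]_n.

Definition tangent_transition (b d : chart Q) : E * E -> E * E :=
  ccoord (d : chart (tangent Q)) \o param (b : chart (tangent Q)).

(** The left-hand side passes through the chart chosen at [param b x], which varies with the point;
    the cocycle property of the transitions eliminates it. *)
Lemma tangent_transitionE (b d : chart Q) (z : E * E) : overlap b d z.1 ->
  tangent_transition b d z = tangent_lift (transition b d) z.
Proof.
case: z => x y /= bd; have bx : cdom b (param b x) := mf_param hQ bd.1.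
congr (_, _); apply: (transition_comp hQ (c := chart_at (param b x))) => //.
by split; [exact: bd.1 | exact: (mf_chart_at hQ)].
Qed.

Lemma diff_tangent_transition (b d : chart Q) (z : E * E) : overlap b d z.1 ->
  'd (tangent_transition b d) z = 'd (tangent_lift (transition b d)) z
    :> (E * E -> E * E).
Proof.
move=> bdz; apply/esym; apply: near_diffE.
  have oz : open (overlap b d `*` [set: E]) by apply: open_prodT; exact: overlap_open.
  have : \forall y \near z, (overlap b d `*` [set: E]) y.
    exact: (@open_nbhs_nbhs _ z _ (conj oz (conj bdz I))).
  by apply: filterS => y [bdy _]; rewrite tangent_transitionE.
have C := Ck_tangent_lift (overlap_open hQ (b := b) (c := d)) (Ck_transition hQ 2 b d).
exact: (Ck1_diff C (conj bdz I)).
Qed.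

(** Second derivatives of the transition only act on the horizontal component, which is zero here;
    so the vertical component changes like a tangent vector of [Q]. *)
Lemma diff_tangent_transition_vertical (b d : chart Q) (z : E * E) w :
  overlap b d z.1 ->
  'd (tangent_transition b d) z (0, w) = (0, 'd (transition b d) (z.1) w).
Proof.
case: z => x y bdx; rewrite (diff_tangent_transition bdx).
apply: etrans (diff_tangent_lift y 0 w (overlap_open hQ (b := b) (c := d)) bdx
  (Ck_transition hQ 2 b d)) _.
have e1 : 'd (transition b d) x 0 = 0 := linear0 _.
have e2 : 'd (fun z => 'd (transition b d) z y) x 0 = 0 := linear0 _.
congr (_, _); first exact: e1.
exact: (etrans (congr2 +%R e2 erefl) (add0r _)).
Qed.

Lemma tangent_coordK (c : chart Q) (v : tangent Q) : cdom c (tbase v) ->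
  param (c : chart (tangent Q)) (ccoord (c : chart (tangent Q)) v) = v.
Proof. by case: v => q w cq; exact: (tangent_paramE hQ w cq). Qed.

Section Lagrangian.
Variable L : tangent Q -> R.
Hypothesis L_smooth : smooth_fun setT L.

Definition local_momentum (c : chart Q) (z : E * E) : E' :=
  \col_i 'd (local_lagrangian L c) z (0, delta_mx 0 i).

(** On one fibre the passage to the chart [c] is the linear map [jac], so by the chain rule the
    momentum changes by its transpose. *)
Lemma fibD_local (c : chart Q) (v : tangent Q) : cdom c (tbase v) ->
  fibD L v = cojac (chart_at (tbase v)) c (tbase v)
    (local_momentum c (ccoord (c : chart (tangent Q)) v)).
Proof.
case: v => q y /= cq; apply: pair_cov_inj => u; rewrite pair_cojac.
set j := jac (chart_at q) c q.
have lj : linear j by exact: linearP.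
rewrite -[fibD _ _]/(row_grad (fibre_lagrangian L q) y) pair_row_grad.
have dg w : is_diff w (fun w => (ccoord c q, j w)) (fun w => (0, j w)).
  exact: (is_diff_pair (is_diff_cst _ w) (mx_linear_is_diff w lj)).
have lE : fibre_lagrangian L q = fun w => local_lagrangian L c (ccoord c q, j w).
  by apply: funext => w; rewrite /fibre_lagrangian -(tangent_paramE hQ w cq).
have Uz : tcod c (ccoord c q, j y) by split => //; exact: (mf_coord hQ).
have dL : differentiable (local_lagrangian L c) (ccoord c q, j y).
  exact: (Ck1_diff (Ck_local_lagrangian L_smooth 1 c) Uz).
rewrite lE; apply: etrans (diff_affine u (dg y) dL) _.
have l2 : linear (fun u : E => 'd (local_lagrangian L c) (ccoord c q, j y) (0, u) : R^o).
  move=> k u1 u2; rewrite -linearP; congr ('d _ _ (_, _)).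
  by rewrite /= scaler0 addr0.
exact/esym/(pair_cov_col (j u) l2).
Qed.

Lemma legendre_local (c : chart Q) (v : tangent Q) : cdom c (tbase v) ->
  legendre L v = param (c : chart (cotangent Q))
    (ccoord c (tbase v), local_momentum c (ccoord (c : chart (tangent Q)) v)).
Proof.
move=> cq; rewrite /legendre (fibD_local cq) /=.
by rewrite (mf_coordK hQ).
Qed.

(** This is [euler_lagrange_lift] for the transition from the chart chosen at the base point to [c].
    The second-order condition identifies the stored [tfib X] with the direction [(y, a)], whose
    image gives the acceleration read in [c]. *)
Lemma deltaL_local (c : chart Q) (X : tangent (tangent Q)) :
  cdom c (tbase (tbase X)) -> second_order X ->
  vfib (deltaL L X) = cojac (chart_at (tbase (tbase X))) c (tbase (tbase X))
    (euler_lagrange (local_lagrangian L c)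
      (ccoord (c : chart (tangent Q)) (tbase X))
      (ccoord (c : chart (tangent (tangent Q))) X).2.2).
Proof.
move=> cq X2; rewrite (deltaLE hQ L_smooth).
set q := tbase (tbase X) in cq *; set b := chart_at q.
have bq : cdom b q := mf_chart_at hQ q.
have bc := overlap_coord hQ bq cq.
set y := tfib (tbase X); set a := (tfib X).2.
have zE : ccoord (b : chart (tangent Q)) (tbase X) = (ccoord b q, y).
  by congr (_, _); exact: jac_id.
have TzE : tangent_lift (transition b c) (ccoord b q, y) =
    ccoord (c : chart (tangent Q)) (tbase X).
  by congr (_, _); rewrite /transition /= (mf_coordK hQ).
have aE : (ccoord (c : chart (tangent (tangent Q))) X).2 =
    'd (tangent_lift (transition b c)) (ccoord b q, y) (y, a).
  rewrite -(diff_tangent_transition (z := (ccoord b q, y)) bc) -zE.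
  rewrite -[_.2]/('d (tangent_transition b c)
    (ccoord (b : chart (tangent Q)) (tbase X)) (tfib X)).
  by congr ('d _ _ _); rewrite [LHS]surjective_pairing X2.
apply: pair_cov_inj => u; rewrite pair_cojac.
rewrite -[chart_at (tbase X)]/b zE aE -TzE.
apply: (euler_lagrange_lift (V := overlap b c) (W := tcod c)) => //.
- exact: overlap_open.
- exact: Ck_transition.
- exact: tcod_open.
- exact: Ck_local_lagrangian.
- move=> z bz; split => //=; apply: (mf_coord hQ); exact: bz.2.
- move=> z bz; rewrite -(tangent_transitionE bz) /local_lagrangian /=; congr L.
  by rewrite -[RHS]/(param (c : chart (tangent Q)) (ccoord (c : chart (tangent Q))
    (param (b : chart (tangent Q)) z))) tangent_coordK //; exact: bz.2.
Qed.

End Lagrangian.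

(** Changes of charts are linear on cotangent fibres, so second fibre derivatives are tensors and no
    correction term appears. *)
Lemma cohessian_local (c : chart Q) (U : set (cotangent Q)) (h : cotangent Q -> R)
    (p : cotangent Q) a a' :
  open U -> smooth_fun U h -> U p -> cdom c (cbase p) ->
  pair_cov a' (cofibD2 h p a) =
  'd (fun z : E * E' => 'd (h \o param (c : chart (cotangent Q)) : E * E' -> R^o) z
        (0, cojac c (chart_at (cbase p)) (cbase p) a'))
     (ccoord (c : chart (cotangent Q)) p)
     (0, cojac c (chart_at (cbase p)) (cbase p) a) :> R.
Proof.
case: p => q p oU sh Up cq; set B := cojac c _ _.
have oUq := cofibre_open hQ (q := q) oU.
rewrite -[cofibD2 _ _ _]/('d (col_grad (fun a => h (CVec q a))) p a).
rewrite (pair_diff_col_grad _ _ oUq (cofibre_smooth hQ 2 q oU sh) Up).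
have [oV Ch] := smooth_fun_local (c : chart (cotangent Q)) sh.
have dg w : is_diff w (fun w => (ccoord c q, B w)) (fun w => (0, B w)).
  apply: (is_diff_pair (is_diff_cst _ w)); apply: mx_linear_is_diff.
  exact: cojac_linear.
have hE : (fun a => h (CVec q a)) =
    fun w => (h \o param (c : chart (cotangent Q))) (ccoord c q, B w).
  by apply: funext => w /=; rewrite -[in LHS](cotangent_paramE hQ w cq).
rewrite hE.
apply: (diff2_affine a' a oV (Ch 2) _ dg).
split; first by split => //; exact: (mf_coord hQ).
by rewrite /preimage /mkset (cotangent_paramE hQ p cq).
Qed.

End LocalExpressions.

Lemma Ck_proj2 (R : realType) (E F G : normedModType R) k (U : set E)
    (f : E -> (F * G)%type) :
  open U -> Ck k U f -> Ck k U (fun x => (f x).2).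
Proof. by move=> oU; apply: (Ck_linear (g := snd)) => // y; exact: cvg_snd. Qed.

(** * Smoothness of formulas written in coordinates *)

Section SmoothLocalExpressions.
Context {R : realType} {n : nat}.
Local Notation E := 'rV[R]_n.
Local Notation E' := 'cV[R]_n.

Lemma Ck_row (F : normedModType R) k (V : set F) (f : 'I_n -> F -> R^o) :
  open V -> (forall i, Ck k V (f i)) -> Ck k V (fun z => \row_i f i z : E).
Proof.
move=> oV Cf.
have C : Ck k V (fun z => \sum_i f i z *: (delta_mx 0 i : E)).
  by apply: Ck_sum => // i; exact: Ck_scalel.
apply: Ck_eq C => // z _; rewrite [RHS]row_sumE.
by apply: eq_bigr => i _; rewrite mxE.
Qed.

Lemma Ck_col (F : normedModType R) k (V : set F) (f : 'I_n -> F -> R^o) :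
  open V -> (forall i, Ck k V (f i)) -> Ck k V (fun z => \col_i f i z : E').
Proof.
move=> oV Cf.
have C : Ck k V (fun z => \sum_i f i z *: (delta_mx i 0 : E')).
  by apply: Ck_sum => // i; exact: Ck_scalel.
apply: Ck_eq C => // z _; rewrite [RHS]col_sumE.
by apply: eq_bigr => i _; rewrite mxE.
Qed.

(** Point and direction both move, so the uncurried differential is composed with the pair [(f, w)];
    one order of differentiability of [g] is spent. *)
Lemma Ck_diff_along (F G1 G2 : normedModType R) k (V : set F) (W : set G1)
    (g : G1 -> G2) (f w : F -> G1) :
  open V -> Ck k.+1 W g -> (forall z, V z -> W (f z)) ->
  Ck k V f -> Ck k V w -> Ck k V (fun z => 'd g (f z) (w z)).
Proof.
move=> oV [_ Cg] VW Cf Cw.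
apply: (Ck_comp (V := W `*` setT) (f := fun z => (f z, w z)) oV _ _ Cg).
  by move=> z /VW.
exact: Ck_pair.
Qed.

Lemma Ck_euler_lagrange k (V W : set (E * E)) (g : E * E -> R^o) (a : E * E -> E) :
  open V -> open W -> V `<=` W -> Ck k.+2 W g -> Ck k V a ->
  Ck k V (fun z => euler_lagrange g z (a z)).
Proof.
move=> oV oW VW Cg Ca; apply: Ck_col => // i.
have Cid : Ck k V (fun z => z) by exact: Ck_id.
have Csnd : Ck k V (fun z : E * E => z.2) by exact: Ck_snd.
have C1 : Ck k V (fun z => 'd g z (delta_mx 0 i, 0) : R^o).
  by apply: (Ck_diff_along oV (CkS Cg) VW Cid); exact: Ck_cst.
have C2 : Ck k V (fun z => 'd (fun y => 'd g y (0, delta_mx 0 i)) z (z.2, a z) : R^o).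
  apply: (Ck_diff_along oV (Ck_diff (0, delta_mx 0 i) oW Cg) VW Cid).
  exact: Ck_pair.
have C3 := Ck_add oV C1 (Ck_mul oV (Ck_cst k V (-1 : R^o)) C2).
by apply: Ck_eq C3 => // z _; rewrite mulN1r.
Qed.

Lemma Ck_scale_row (F : normedModType R) k (V : set F) (f : F -> R^o) (g : F -> E) :
  open V -> Ck k V f -> Ck k V g -> Ck k V (fun z => f z *: g z).
Proof.
move=> oV Cf Cg.
have Cgi i : Ck k V (fun z => g z 0 i : R^o).
  have li := pair_cov_linear (delta_mx i 0 : E').
  pose fM := GRing.isLinear.Build _ _ _ _ _ li.
  pose fL : {linear E -> R^o} := HB.pack (pair_cov (delta_mx i 0 : E') : E -> R^o) fM.
  have C := Ck_linear (g := fL) oV (mx_linear_continuous li) Cg.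
  by apply: Ck_eq C => // z _; rewrite /= pair_cov_deltal.
apply: Ck_eq (Ck_row oV (fun i => Ck_mul oV Cf (Cgi i))) => // z _.
by apply/rowP => i; rewrite !mxE.
Qed.

End SmoothLocalExpressions.

(** * The field [D0] in fixed charts and its smoothness *)

Section LocalField.
Context {R : realType} {n : nat} {Q : charted 'rV[R]_n}.
Hypothesis hQ : smooth_manifold Q.
Local Notation E := 'rV[R]_n.
Local Notation E' := 'cV[R]_n.

Definition local_cohessian (h : cotangent Q -> R) (c : chart Q) (z : E * E') (a : E') : E :=
  \row_i 'd (fun y : E * E' => 'd (h \o param (c : chart (cotangent Q)) : E * E' -> R^o) y
                                 (0, delta_mx i 0)) z (0, a).

Lemma jac_cofibD2 (c : chart Q) (U : set (cotangent Q)) h (p : cotangent Q) a :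
  open U -> smooth_fun U h -> U p -> cdom c (cbase p) ->
  jac (chart_at (cbase p)) c (cbase p) (cofibD2 h p a) =
  local_cohessian h c (ccoord (c : chart (cotangent Q)) p)
    (cojac c (chart_at (cbase p)) (cbase p) a).
Proof.
move=> oU sh Up cq; apply/rowP => i; rewrite [RHS]mxE -pair_cov_deltal -pair_cojac.
rewrite (cohessian_local hQ _ _ oU sh Up cq).
by rewrite (cojacK hQ) //; exact: (mf_chart_at hQ).
Qed.

Lemma Ck_local_cohessian (F : normedModType R) k (c : chart Q)
    (U : set (cotangent Q)) h (V : set F) (f : F -> E * E') (a : F -> E') :
  open V -> smooth_fun U h -> (forall z, V z -> ccod c (f z).1) ->
  (forall z, V z -> U (param (c : chart (cotangent Q)) (f z))) ->
  Ck k V f -> Ck k V a -> Ck k V (fun z => local_cohessian h c (f z) (a z)).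
Proof.
move=> oV sh Vc VU Cf Ca.
have [oW Ch] := smooth_fun_local (c : chart (cotangent Q)) sh.
apply: Ck_row => // i.
apply: (Ck_diff_along oV (Ck_diff (0, delta_mx i 0) oW (Ch k.+2))) => //.
- by move=> z Vz; split; [split => //; exact: Vc | exact: VU].
- by apply: Ck_pair => //; exact: Ck_cst.
Qed.

Lemma tangent_paramK (c : chart Q) (z : E * E) : ccod c z.1 ->
  ccoord (c : chart (tangent Q)) (param (c : chart (tangent Q)) z) = z.
Proof.
case: z => x y cx; have cq : cdom c (param c x) := mf_param hQ cx.
have cc : overlap c c x by split.
apply: etrans (tangent_transitionE hQ (z := (x, y)) cc) _.
congr (_, _); first exact: (mf_paramK hQ).
have := jac_id hQ y cq; rewrite /jac /transition (mf_paramK hQ) //.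
Qed.

Lemma tangent2_coordE (d : chart Q) (Y : tangent (tangent Q)) :
  ccoord (d : chart (tangent (tangent Q))) Y =
  (ccoord (d : chart (tangent Q)) (tbase Y),
   'd (tangent_transition (chart_at (tbase (tbase Y))) d)
     (ccoord (chart_at (tbase (tbase Y)) : chart (tangent Q)) (tbase Y)) (tfib Y)).
Proof. exact: erefl. Qed.

Variable L : tangent Q -> R.
Hypothesis L_smooth : smooth_fun setT L.
Variables (U : set (cotangent Q)) (m : nat) (phi : 'I_m -> cotangent Q -> R).
Hypothesis U_open : open U.
Hypothesis phi_smooth : forall mu, smooth_fun U (phi mu).
Variable H : cotangent Q -> R.
Hypothesis H_smooth : smooth_fun U H.
Variable Omega : set (tangent Q).
Hypothesis Omega_sub : Omega `<=` legendre L @^-1` U.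
Variable lambda : 'I_m -> tangent Q -> R.
Hypothesis lambda_smooth : forall mu, smooth_fun Omega (lambda mu).
Hypothesis Omega_open : open Omega.
Variable X0 : tangent Q -> tangent (tangent Q).
Hypothesis X0_smooth : smooth_on setT X0.
Hypothesis X0_base : forall v, tbase (X0 v) = v.
Hypothesis X0_second_order : forall v, second_order (X0 v).

Definition local_legendre (c : chart Q) (z : E * E) : E * E' :=
  (z.1, local_momentum L c z).

Definition local_force (c : chart Q) (z : E * E) : E' :=
  euler_lagrange (local_lagrangian L c) z
    (ccoord (c : chart (tangent (tangent Q))) (X0 (param (c : chart (tangent Q)) z))).2.2.

Definition local_correction (c : chart Q) (z : E * E) : E :=
  local_cohessian H c (local_legendre c z) (local_force c z) +
  \sum_mu lambda mu (param (c : chart (tangent Q)) z) *: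
    local_cohessian (phi mu) c (local_legendre c z) (local_force c z).

(** Each ingredient is moved to [c]: the Legendre image ([FE]), the Euler-Lagrange covector ([fE]),
    the second fibre derivatives ([hE]). The Jacobians on covectors cancel, and a single [jac] on
    the resulting vector remains. *)
Lemma jac_Mop (c : chart Q) (z : E * E) :
  let v := param (c : chart (tangent Q)) z in
  ccod c z.1 -> Omega v ->
  jac (chart_at (tbase v)) c (tbase v)
    (Mop L H phi lambda v (vfib (deltaL L (X0 v)))) = local_correction c z.
Proof.
move=> v cz Ov; have Uv := Omega_sub Ov.
have cq : cdom c (tbase v) := mf_param hQ cz.
have bq : cdom (chart_at (tbase v)) (tbase v) := mf_chart_at hQ _.
have zE : ccoord (c : chart (tangent Q)) v = z by exact: tangent_paramK.
have FE : ccoord (c : chart (cotangent Q)) (legendre L v) = local_legendre c z.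
  congr (_, _); first exact: (congr1 fst zE).
  rewrite -[LHS]/(cojac c (chart_at (tbase v)) (tbase v) (fibD L v)).
  by rewrite (fibD_local hQ L_smooth cq) zE (cojacK hQ).
have fE : cojac c (chart_at (tbase v)) (tbase v) (vfib (deltaL L (X0 v))) = local_force c z.
  have cX : cdom c (tbase (tbase (X0 v))) by rewrite X0_base.
  rewrite (deltaL_local hQ L_smooth cX (X0_second_order v)) X0_base (cojacK hQ) //.
  by rewrite zE.
have hE h : smooth_fun U h ->
    jac (chart_at (tbase v)) c (tbase v)
      (cofibD2 h (legendre L v) (vfib (deltaL L (X0 v)))) =
    local_cohessian h c (local_legendre c z) (local_force c z).
  move=> sh; rewrite -FE -fE.
  exact: (jac_cofibD2 (p := legendre L v) _ U_open sh Uv cq).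
rewrite /Mop /local_correction -hE //.
apply: etrans (linearD ('d (transition (chart_at (tbase v)) c) _) _ _) _.
congr (_ + _).
apply: etrans (linear_sum ('d (transition (chart_at (tbase v)) c) _) _ _ _) _.
apply: eq_bigr => mu _; rewrite -hE //.
by rewrite /jac linearZ.
Qed.

Lemma local_accel_smooth k (c : chart Q) : Ck k (tcod c) (fun z =>
  (ccoord (c : chart (tangent (tangent Q))) (X0 (param (c : chart (tangent Q)) z))).2.2).
Proof.
have /= [_ /(_ k)] := X0_smooth (c : chart (tangent Q)) (c : chart (tangent (tangent Q))).
set V := (X in Ck k X) => CX.
pose f z := ccoord (c : chart (tangent (tangent Q))) (X0 (param (c : chart (tangent Q)) z)).
have CX' : Ck k (tcod c) f.
  apply: Ck_sub CX => z cz; split => //; split => //.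
  by rewrite /preimage /mkset X0_base; exact: (mf_param hQ cz.1).
have oU : open (tcod c) by exact: tcod_open.
have C2 := Ck_proj2 oU CX'.
have C3 := Ck_proj2 (f := fun z => (f z).2) oU C2.
by apply: Ck_eq C3.
Qed.

Lemma local_domain_open (c : chart Q) :
  open (tcod c `&` param (c : chart (tangent Q)) @^-1` Omega).
Proof. exact: Omega_open. Qed.

Lemma Ck_local_correction k (c : chart Q) :
  Ck k (tcod c `&` param (c : chart (tangent Q)) @^-1` Omega) (local_correction c).
Proof.
set V := _ `&` _; have oV : open V by exact: local_domain_open.
have Vc z : V z -> ccod c z.1 by case=> -[].
have oU : open (tcod c) by exact: tcod_open.
have VU : V `<=` tcod c by move=> z [].
have Cid : Ck k V (fun z => z) by exact: Ck_id.
have CF : Ck k V (local_legendre c).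
  apply: Ck_pair => //; first exact: Ck_fst.
  apply: Ck_col => // i.
  apply: (Ck_diff_along oV (Ck_local_lagrangian L_smooth k.+1 c) VU Cid).
  exact: Ck_cst.
have Cf : Ck k V (local_force c).
  apply: (Ck_euler_lagrange oV oU VU (Ck_local_lagrangian L_smooth k.+2 c)).
  exact: Ck_sub VU (local_accel_smooth k c).
have VUF z : V z -> U (param (c : chart (cotangent Q)) (local_legendre c z)).
  move=> [[cz _] Oz]; have cq : cdom c (param c z.1) := mf_param hQ cz.
  have := Omega_sub Oz; rewrite /preimage /mkset.
  rewrite (legendre_local hQ L_smooth (v := param (c : chart (tangent Q)) z) cq).
  by rewrite (tangent_paramK cz) [tbase _]/= (mf_paramK hQ cz).
have Ch h : smooth_fun U h ->
    Ck k V (fun z => local_cohessian h c (local_legendre c z) (local_force c z)).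
  by move=> sh; exact: (Ck_local_cohessian oV sh).
apply: Ck_add => //; first exact: Ch.
apply: Ck_sum => // mu; apply: Ck_scale_row => //; last exact: Ch.
by have [_] := smooth_fun_local (c : chart (tangent Q)) (lambda_smooth mu).
Qed.

Lemma D0_smooth : smooth_on Omega (D0 L H phi lambda X0).
Proof.
set D := D0 L H phi lambda X0.
(* The charts of both tangent bundles are indexed by [chart Q], so [c] and [d] can be handled as
   charts of [Q]. *)
suff local (c d : chart Q) :
    let V := tcod c `&` param (c : chart (tangent Q)) @^-1`
      (Omega `&` D @^-1` cdom (d : chart (tangent (tangent Q)))) in
    open V /\ smooth_in V (ccoord (d : chart (tangent (tangent Q))) \o D \o
      param (c : chart (tangent Q))) by move=> c d; exact: (local c d).
move=> V.
(* Since [D v] lies over [v], whether it belongs to the domain of [d] depends on the base point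
   only; the domain is thus open without any knowledge of the continuity of [D]. *)
have VE : V = (tcod c `&` param (c : chart (tangent Q)) @^-1` Omega) `&`
    (overlap c d `*` setT).
  apply/seteqP; split => z.
    move=> [cz [Oz]]; rewrite /preimage /mkset /D D0E // => dz.
    by split => //; split => //; split => //; exact: cz.1.
  move=> [[cz Oz] [[_ dz] _]]; split => //; split => //.
  by rewrite /preimage /mkset /D D0E.
have oV : open V.
  rewrite VE; apply: openI; first exact: local_domain_open.
  by apply: open_prodT; exact: overlap_open.
split=> // k.
have V1 z : V z -> ccod c z.1 by rewrite VE => -[[[]]].
have VO z : V z -> Omega (param (c : chart (tangent Q)) z) by rewrite VE => -[[]].
have Vcd z : V z -> overlap c d z.1 by rewrite VE => -[_ []].
have /= [_ /(_ k) CX] := X0_smooth (c : chart (tangent Q)) (d : chart (tangent (tangent Q))).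
have {}CX : Ck k V (ccoord (d : chart (tangent (tangent Q))) \o X0 \o
    param (c : chart (tangent Q))).
  apply: Ck_sub CX => z Vz; split; first by split => //; exact: V1.
  by split => //; rewrite /preimage /mkset X0_base; exact: (Vcd z Vz).2.
have Cw : Ck k V (local_correction c).
  by apply: Ck_sub (Ck_local_correction k c); rewrite VE => z [].
have Cfst : Ck k V (fun z : E * E => z.1) by exact: Ck_fst.
(* The correction is a vector read in the source chart [c]; the target chart [d] sees it through the
   Jacobian of the transition. *)
have Cv : Ck k V (fun z => 'd (transition c d) (z.1) (local_correction c z)).
  exact: (Ck_diff_along oV (Ck_transition hQ k.+1 c d) Vcd Cfst Cw).
have C0 (F G : normedModType R) (f : E * E -> G) : Ck k V f -> Ck k V (fun z => (0 : F, f z)).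
  by move=> Cf; apply: Ck_pair => //; exact: Ck_cst.
(* In these charts [D0] is [X0] plus a term whose base and horizontal parts are zero, because
   vertical vectors stay vertical under [tangent_transition]. *)
apply: Ck_eq (Ck_add oV CX (C0 (E * E)%type _ _ (C0 E _ _ Cv))) => // z Vz.
set v := param (c : chart (tangent Q)) z.
have cq : cdom c (tbase v) := mf_param hQ (V1 z Vz).
have dq : cdom d (tbase v) := (Vcd z Vz).2.
have bq : cdom (chart_at (tbase v)) (tbase v) := mf_chart_at hQ _.
have bd := overlap_coord hQ bq dq.
pose w := Mop L H phi lambda v (vfib (deltaL L (X0 v))).
pose T := 'd (tangent_transition (chart_at (tbase v)) d)
  (ccoord (chart_at (tbase v) : chart (tangent Q)) v).
have TE Y : tbase Y = v -> ccoord (d : chart (tangent (tangent Q))) Y =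
    (ccoord (d : chart (tangent Q)) v, T (tfib Y)).
  by move=> Yv; rewrite tangent2_coordE Yv.
rewrite [RHS](_ : _ = ccoord (d : chart (tangent (tangent Q))) (D v)) //.
rewrite [X in X + _](_ : _ = ccoord (d : chart (tangent (tangent Q))) (X0 v)) //.
rewrite (TE (X0 v)) // (TE (D v)) /D ?D0E //.
congr (_, _); first exact: addr0.
apply/esym/(etrans (linearD T _ _)); congr (_ + _).
apply: etrans (diff_tangent_transition_vertical hQ w
  (z := ccoord (chart_at (tbase v) : chart (tangent Q)) v) bd) _.
congr (_, _); rewrite -(jac_Mop (V1 z Vz) (VO z Vz)) -/v -/w.
apply: etrans (esym (jac_comp hQ w bq cq dq)) _.
by rewrite /jac -/v (mf_paramK hQ (V1 z Vz)).
Qed.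

End LocalField.

Theorem proposition5 (R : realType) (n : nat) (Q : charted 'rV[R]_n)
    (Q_manifold : smooth_manifold Q)
    (L : tangent Q -> R) (L_smooth : smooth_fun setT L)
    (L_regular : almost_regular L)
    (V1_submanifold : closed_submanifold (V1 L))
    (U : set (cotangent Q)) (U_open : open U)
    (m : nat) (phi : 'I_m -> cotangent Q -> R)
    (phi_constraints : independent_primary_constraints L U phi)
    (H : cotangent Q -> R) (H_hamiltonian : hamiltonian_function L U H)
    (Omega : set (tangent Q)) (Omega_open : open Omega)
    (Omega_sub : Omega `<=` legendre L @^-1` U)
    (lambda : 'I_m -> tangent Q -> R)
    (lambda_smooth : forall mu, smooth_fun Omega (lambda mu))
    (lambda_id : forall v, Omega v ->
       tfib v = gamma L H v + \sum_mu lambda mu v *: gamma L (phi mu) v)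
    (X0 : tangent Q -> tangent (tangent Q))
    (X0_second_order : second_order_field setT X0) :
  [/\ primary_field L Omega (D0 L H phi lambda X0),
      forall v, Omega v ->
        deltaL L (D0 L H phi lambda X0 v) =
        VCov v (\sum_mu chi L X0 (phi mu) v *: vfib (Dv (lambda mu) v)),
      forall v, Omega v -> V1 L v ->
        \sum_mu chi L X0 (phi mu) v *: vfib (Dv (lambda mu) v) = 0 &
      forall v, Omega v -> (V1 L v <-> forall mu, chi L X0 (phi mu) v = 0)].
Proof.
have [phi_smooth _ phi_zero] := phi_constraints.
have [H_smooth _] := H_hamiltonian.
have [X0_smooth X0_sode] := X0_second_order.
have X0_base v : tbase (X0 v) = v by have [] := X0_sode v I.
have X0_so v : second_order (X0 v) by have [] := X0_sode v I.
have phi0 p : P0 L p -> U p -> forall mu, phi mu p = 0.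
  by move=> Pp Up; apply/(phi_zero p Up).
have deltaLD0 v : Omega v -> deltaL L (D0 L H phi lambda X0 v) =
    VCov v (\sum_mu chi L X0 (phi mu) v *: vfib (Dv (lambda mu) v)).
  exact: (deltaL_D0 Q_manifold L_smooth).
have V1E v : Omega v -> V1 L v <-> forall mu, chi L X0 (phi mu) v = 0.
  exact: (V1_chi Q_manifold L_smooth U_open phi_smooth phi0 H_smooth).
have sum0 v : Omega v -> V1 L v ->
    \sum_mu chi L X0 (phi mu) v *: vfib (Dv (lambda mu) v) = 0.
  by move=> Ov /(V1E v Ov) chi0; rewrite big1 // => mu _; rewrite chi0 scale0r.
split => //.
split; last by move=> v Ov V1v; rewrite deltaLD0 //; exact: sum0.
split; first exact: (D0_smooth Q_manifold L_smooth U_open).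
move=> v Ov; split; first by rewrite D0E.
exact: D0_second_order.
Qed.
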